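(* Let $L$ be an even integral quadratic lattice of rank $n$ and signature $(n-1,1)$ with quadratic form $f$, and let $X_f$ be its minimal distance graph. Then: (i) The connected components of $X_f$ fall into finitely many isomorphism types (as graphs). (ii) Each connected component of $X_f$ is either a single vertex or an infinite graph on which some Coxeter group acts by graph isometries, transitively on vertices and with finite vertex stabilizers. (iii) If $\Sigma$ is a connected component of $X_f$, then the group $R_{-2}(\Sigma)=\langle r_v : v\in\Sigma\rangle$ is up to index $2$ contained in $R_2(L)$; that is, $R_{-2}(\Sigma)\cap R_2(L)$ has index at most $2$ in $R_{-2}(\Sigma)$.
   Context: $L$ is a free $\mathbb Z$-module of rank $n\ge 3$ with a nondegenerate integral symmetric bilinear form $(\cdot,\cdot)$, and $f(x)=(x,x)$; $L\otimes\mathbb R$ has signature $(n-1,1)$ ($n-1$ positive and one negative direction), and $f$ is assumed isotropic over $\mathbb Q$. $L$ (or $f$) is even if $(x,x)\in2\mathbb Z$ for all $x\in L$ and $(x,y)$ is odd for some $x,y\in L$. $\mathrm O(L)$ is the group of isometries of $L$. For $k\in\mathbb Z\setminus\{0\}$, $V_k(L)=\{v\in L:(v,v)=k\}$. For $v$ with $(v,v)\ne0$, $r_v(y)=y-\frac{2(v,y)}{(v,v)}v$; for $v\in V_{\pm2}(L)$ one has $r_v\in \mathrm O(L)$. $R_2(L)$ is the subgroup of $\mathrm O(L)$ generated by all $r_v$ with $v\in V_2(L)$. The minimal distance graph $X_f$ (for $f$ even) has vertex set $V_{-2}(L)$, with $u,w$ joined by an edge iff $(u,w)=-3$. *)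

(* Defs.v *)
From HB Require Import structures.
From mathcomp Require Import all_boot all_order all_algebra.
From mathcomp Require Import boolp classical_sets functions cardinality reals.

Set Implicit Arguments.
Unset Strict Implicit.
Unset Printing Implicit Defensive.

Import Order.TTheory GRing.Theory Num.Theory.
Local Open Scope classical_set_scope.
Local Open Scope ring_scope.

(* Quadratic lattices: a basis of the free Z-module L identifies it with
   'rV[int]_n, and the bilinear form with its Gram matrix. *)

Definition form (R : pzRingType) n (A : 'M[R]_n) (x y : 'rV[R]_n) : R :=
  (x *m A *m y^T) 0 0.

Definition qform (R : pzRingType) n (A : 'M[R]_n) (x : 'rV[R]_n) : R :=
  form A x x.

Definition has_signature (R : realFieldType) n (A : 'M[R]_n) (p q : nat) :=
  exists (P : 'M[R]_n) (d : 'rV[R]_n),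
    [/\ P \in unitmx, P *m A *m P^T = diag_mx d,
        #|[set i | 0 < d 0 i]%SET| = p & #|[set i | d 0 i < 0]%SET| = q].

Definition isotropic (F : fieldType) n (A : 'M[F]_n) :=
  exists2 x : 'rV[F]_n, x != 0 & qform A x = 0.

Definition even_lattice n (A : 'M[int]_n) :=
  (forall x, (2 %| qform A x)%Z) /\ (exists x y, ~~ (2 %| form A x y)%Z).

(* Isometries act on the right: y |-> y *m g. *)
Definition is_isometry n (A g : 'M[int]_n) :=
  (g \in unitmx) && (g *m A *m g^T == A).

Record isom n (A : 'M[int]_n) :=
  Isom { isom_mx : 'M[int]_n; isomP : is_isometry A isom_mx }.

HB.instance Definition _ n (A : 'M[int]_n) := [isSub for @isom_mx n A].
HB.instance Definition _ n (A : 'M[int]_n) := [Choice of isom A by <:].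

Section IsomGroup.
Variables (n : nat) (A : 'M[int]_n).

Lemma is_isometry1 : is_isometry A 1%:M.
Proof. by rewrite /is_isometry unitmx1 trmx1 mulmx1 mul1mx /=. Qed.

Lemma is_isometryM (g h : isom A) : is_isometry A (isom_mx g *m isom_mx h).
Proof.
case: g h => g /andP[ug /eqP gA] [h /andP[uh /eqP hA]] /=.
rewrite /is_isometry unitmx_mul ug uh /= trmx_mul.
by rewrite -!mulmxA (mulmxA h) (mulmxA _ h^T) hA mulmxA gA.
Qed.

Lemma is_isometryV (g : isom A) : is_isometry A (invmx (isom_mx g)).
Proof.
case: g => g /andP[ug /eqP gA] /=.
rewrite /is_isometry unitmx_inv ug /= trmx_inv -{1}gA -!mulmxA.
by rewrite mulmxV ?unitmx_tr // mulmx1 mulKmx.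
Qed.

Definition isom_one : isom A := Isom is_isometry1.
Definition isom_mul (g h : isom A) : isom A := Isom (is_isometryM g h).
Definition isom_inv (g : isom A) : isom A := Isom (is_isometryV g).

Lemma isom_mulA : associative isom_mul.
Proof. by move=> f g h; apply: val_inj; rewrite /= mulmxA. Qed.

Lemma isom_mul1g : left_id isom_one isom_mul.
Proof. by move=> g; apply: val_inj; rewrite /= mul1mx. Qed.

Lemma isom_mulg1 : right_id isom_one isom_mul.
Proof. by move=> g; apply: val_inj; rewrite /= mulmx1. Qed.

Lemma isom_mulVg : left_inverse isom_one isom_inv isom_mul.
Proof.
by move=> [g gP]; apply: val_inj; rewrite /= mulVmx //; case/andP: gP.
Qed.

Lemma isom_mulgV : right_inverse isom_one isom_inv isom_mul.
Proof.
by move=> [g gP]; apply: val_inj; rewrite /= mulmxV //; case/andP: gP.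
Qed.

HB.instance Definition _ := isGroup.Build (isom A)
  isom_mulA isom_mul1g isom_mulg1 isom_mulVg isom_mulgV.

End IsomGroup.

(* The integer division is exact when (v, v) = 2 or (v, v) = -2. *)
Definition reflection n (A : 'M[int]_n) (v y : 'rV[int]_n) : 'rV[int]_n :=
  y - ((2 * form A v y) %/ qform A v)%Z *: v.

Lemma reflection_isom n (A : 'M[int]_n) (v : 'rV[int]_n) :
  A^T = A -> qform A v = 2 \/ qform A v = - 2 ->
  exists g : isom A, forall y, y *m isom_mx g = reflection A v y.
Proof.
move=> As hq; set q := qform A v in hq.
have [c cq cE] : exists2 c : int, c * q = 2 & forall a, ((2 * a) %/ q)%Z = c * a.
  case: hq => ->; [exists 1 | exists (- 1)] => // a.
    by rewrite mulKz // mul1r.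
  by rewrite divzN mulKz // mulN1r.
pose u := A *m v^T.
have uT : u^T = v *m A by rewrite trmx_mul trmxK As.
have vu : v *m u = q%:M by rewrite mulmxA [LHS]mx11_scalar.
pose M := 1%:M - c *: (u *m v).
have MM : M *m M = 1%:M.
  have -> : M *m M = 1%:M - (2 * c) *: (u *m v) + (c * c) *: (u *m v *m (u *m v)).
    rewrite mulmxBl mul1mx mulmxBr mulmx1 -scalemxAl -scalemxAr scalerA opprB.
    by rewrite mulr_natl mulr2n scalerDl opprD !addrA addrAC.
  have -> : u *m v *m (u *m v) = q *: (u *m v).
    by rewrite -mulmxA (mulmxA v) vu mul_scalar_mx -scalemxAr.
  by rewrite scalerA -mulrA cq mulrC subrK.
have MA : M *m A *m M^T = A.
  have -> : M *m A = A *m M^T.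
    rewrite linearB /= trmx1 linearZ /= trmx_mul mulmxBl mulmxBr mul1mx mulmx1.
    by rewrite -scalemxAl -scalemxAr -mulmxA -uT mulmxA.
  by rewrite -mulmxA -trmx_mul MM trmx1 mulmx1.
have MP : is_isometry A M.
  by apply/andP; split; [case/mulmx1_unit: MM | apply/eqP].
exists (Isom MP) => y; rewrite /reflection cE /= mulmxBr mulmx1 -scalemxAr.
have -> : form A v y = (y *m u) 0 0.
  by rewrite /form -uT -trmx_mul mxE.
by rewrite mulmxA [y *m u]mx11_scalar mul_scalar_mx scalerA !mxE.
Qed.

Definition is_subgroup (G : groupType) (H : set G) :=
  [/\ H 1%g, forall x y, H x -> H y -> H (x * y)%g & forall x, H x -> H x^-1%g].

Definition generated (G : groupType) (S : set G) : set G :=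
  [set x | forall H : set G, is_subgroup H -> S `<=` H -> H x].

(* For subgroups K <= H: the left cosets t K of K in H number at most k. *)
Definition index_le (G : groupType) (H K : set G) (k : nat) :=
  exists s : seq G, [/\ (size s <= k)%N, (forall t, t \in s -> H t) &
    forall x, H x -> exists2 t, t \in s & K (t^-1 * x)%g].

Definition refl_group n (A : 'M[int]_n) (V : set 'rV[int]_n) : set (isom A) :=
  generated [set g | exists2 v, V v & forall y, y *m isom_mx g = reflection A v y].

Arguments refl_group {n} A V.

Definition vectors_of_norm n (A : 'M[int]_n) (k : int) : set 'rV[int]_n :=
  [set v | qform A v = k].

Record graph := Graph { vertex :> Type; adj : rel vertex }.

Definition induced (X : graph) (S : set X) : graph :=
  @Graph S (fun x y => adj (val x) (val y)).

Definition connected_to (X : graph) (x y : X) :=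
  exists2 p : seq X, path (@adj X) x p & last x p = y.

Definition is_component (X : graph) (S : set X) :=
  exists x : X, S = [set y | connected_to x y].

Definition graph_isomorphic (X Y : graph) :=
  exists2 h : X -> Y, bijective h & forall x y, adj (h x) (h y) = adj x y.

Definition walk_length (X : graph) (x y : X) (k : nat) :=
  exists p : seq X, [/\ path (@adj X) x p, last x p = y & size p = k].

Definition graph_dist (X : graph) (x y : X) (k : nat) :=
  walk_length x y k /\ forall l, walk_length x y l -> (k <= l)%N.

Definition graph_isometry (X : graph) (h : X -> X) :=
  bijective h /\ forall x y k, graph_dist (h x) (h y) k <-> graph_dist x y k.

(* Coxeter matrices of arbitrary rank; the entry 0 stands for infinity. *)
Definition coxeter_matrix (I : Type) (m : I -> I -> nat) :=
  (forall i j, m i j = m j i) /\ (forall i j, m i j = 1%N <-> i = j).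

Definition coxeter_relations (I : Type) (m : I -> I -> nat) (G : groupType)
    (s : I -> G) := forall i j, ((s i * s j) ^+ m i j)%g = 1%g.

(* W = < s_i | (s_i s_j)^(m i j) = 1 >, by the universal property. *)
Definition coxeter_group (W : groupType) :=
  exists (I : Type) (m : I -> I -> nat) (s : I -> W),
    [/\ coxeter_matrix m, coxeter_relations m s &
      forall (G : groupType) (t : I -> G), coxeter_relations m t ->
        exists! h : W -> G, {morph h : x y / (x * y)%g} /\ h \o s = t].

Definition is_group_action (W : groupType) (T : Type) (a : W -> T -> T) :=
  (forall x, a 1%g x = x) /\ (forall g h x, a (g * h)%g x = a g (a h x)).

Definition min_dist_graph n (A : 'M[int]_n) : graph :=
  @Graph {v : 'rV[int]_n | qform A v == - 2}
    (fun u w => form A (val u) (val w) == - 3).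

(* Main.v *)
From HB Require Import structures.
Require Import Defs.
From mathcomp Require Import all_boot all_order all_algebra.
From mathcomp Require Import boolp classical_sets functions cardinality reals.
From mathcomp Require Import zify ring lra.
Import Order.TTheory GRing.Theory Num.Theory.
Local Open Scope classical_set_scope.
Local Open Scope ring_scope.

Set Implicit Arguments.
Unset Strict Implicit.
Unset Printing Implicit Defensive.

Local Notation form := Defs.form.

(** Write [r_e] for the reflection in a vector [e] of norm 2 or -2.  If [u] and
    [w] are adjacent vertices, then [e = u - w] has norm [-2 - 2 + 6 = 2], and
    [r_e] exchanges [u] and [w] ([edge_norm], [edge_refl]).  This makes every
    edge a symmetry of its component, and most of the theorem comes from it.

    The subgroup of index 2.  Along an edge, [r_w = r_e r_u r_e], hence
    [r_u r_w] is the product of the reflections in [e r_u] and [e], both of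
    norm 2.  By connectedness all [r_u r_w] with [u], [w] in one component lie in
    [R_2], which is normal, so that 1 and a single [r_u] represent all cosets
    ([component_refl_index]).

    Finitely many types.  For a vertex [u] the form [(y, y) + (u, y) ^ 2], its
    majorant, is positive definite, integral, and has the determinant of the
    lattice up to sign.  Hermite's reduction theory gives a basis in which its
    Gram matrix is bounded in terms of that determinant only ([bounded_basis]),
    and then the pairings of [u] with that basis are bounded too.  These finitely
    many data determine [u] up to isometries of the lattice ([marking_orbit]),
    and vertices in one orbit have isomorphic components.

    Coxeter groups.  On a component [S] with an edge, take the group generated by
    the reflections of norm 2 that preserve [S].  It is transitive, by the edge
    reflections.  A vertex stabilizer preserves the definite majorant of the
    vertex, so it is finite.  The component is infinite because the point
    reflections in [u] and [w] generate a geodesic through the edge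
    ([edge_infinite]).

    There remains the fact, due to Vinberg, that a group [W] generated by
    reflections of a Lorentzian lattice is a Coxeter group
    ([reflection_group_coxeter]).  Choose an integral vector [p] of negative norm
    that is orthogonal to no vector of norm 2, and let [N w] be the set of
    reflections in [W] whose mirrors separate [p] from [w p].  Then [N] satisfies
    the cocycle rule [N (x y) = N x + x (N y) x^-1], where [+] is symmetric
    difference.  Call [s] simple if [N s] contains only [s].  The simple
    reflections generate [W], by induction on the positive integer [(e, p)] for the
    root [e] of a reflection ([descent]).  From the cocycle one
    reads off the exchange condition, and the exchange condition gives the Coxeter
    presentation by Matsumoto's theorem ([cocycle_coxeter]). *)

(** * Orders of group elements *)

Section Order.
Context (G : groupType).
Implicit Types x : G.

Definition has_exponent x k := (0 < k)%N && ((x ^+ k)%g == 1%g).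

(** Zero for an element of infinite order, which is the code for infinity in
    a Coxeter matrix. *)
Definition group_order x : nat :=
  if pselect (exists k, has_exponent x k) is left e then ex_minn e else 0.

Lemma expg_order x : (x ^+ group_order x = 1)%g.
Proof.
rewrite /group_order; case: pselect => [e|//].
by case: ex_minnP => k /andP[_ /eqP].
Qed.

Lemma group_order_dvd x k : (0 < k)%N -> (x ^+ k = 1)%g ->
  (group_order x %| k)%N.
Proof.
move=> k0 xk; have := expg_order x; rewrite /group_order.
case: pselect => [e|[]]; last by exists k; rewrite /has_exponent k0 xk eqxx.
case: ex_minnP => m /andP[m0 _] mmin xm; rewrite /dvdn; apply/negPn/negP.
rewrite -lt0n => r0; have := ltn_pmod k m0; rewrite ltnNge mmin //.
apply/andP; split => //; apply/eqP; rewrite -xk [in RHS](divn_eq k m).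
by rewrite expgnDr mulnC expgnA xm expg1n mul1g.
Qed.

Lemma group_order_eq1 x : group_order x = 1%N <-> x = 1%g.
Proof.
split=> [o1|->]; first by rewrite -[x]expg1 -o1 expg_order.
by apply/eqP; rewrite -dvdn1; apply: group_order_dvd => //; rewrite expg1.
Qed.

Lemma group_orderV x : group_order x^-1%g = group_order x.
Proof.
rewrite /group_order.
have E k : has_exponent x^-1%g k = has_exponent x k.
  by rewrite /has_exponent expVgn invg_eq1.
case: pselect => [e|ne]; case: pselect => [e'|ne'] //.
- case: ex_minnP => k kP kmin; case: ex_minnP => l lP lmin.
  by apply/anti_leq; rewrite kmin ?lmin // ?E // -E.
- by case: ne'; case: e => k; rewrite E; exists k.
- by case: ne; case: e' => k; rewrite -E; exists k.
Qed.

End Order.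

(** * Words in involutions and the exchange condition *)

Section Words.
Context (I : eqType).

Fixpoint alt (i j : I) k := if k is k'.+1 then i :: alt j i k' else [::].

Definition word_val (G : groupType) (s : I -> G) (a : seq I) : G :=
  foldr (fun i x => (s i * x)%g) 1%g a.

Lemma word_val_cat (G : groupType) (s : I -> G) a b :
  word_val s (a ++ b) = (word_val s a * word_val s b)%g.
Proof. by elim: a => [|i a IH] /=; rewrite ?mul1g // IH mulgA. Qed.

Lemma size_alt i j k : size (alt i j k) = k.
Proof. by elim: k i j => //= k IH i j; rewrite IH. Qed.

Lemma take_alt i j k : take k (alt i j k.+1) = alt i j k.
Proof. by elim: k i j => //= k IH i j; rewrite -[in RHS]IH. Qed.

(** Both sides of the braid relation of length [k] at once: they agree exactly
    when [(s i s j) ^ k = 1]. *)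
Lemma word_val_alt (G : groupType) (s : I -> G) (i j : I) k :
  (s i * s i = 1)%g -> (s j * s j = 1)%g ->
  word_val s (alt i j k) = ((s i * s j) ^+ k * word_val s (alt j i k))%g.
Proof.
elim: k i j => [|k IH] i j ii jj /=; first by rewrite expg0 mul1g.
rewrite {1}IH //.
have C n : (s i * (s j * s i) ^+ n = (s i * s j) ^+ n * s i)%g.
  elim: n => [|n IHn]; first by rewrite !expg0 mulg1 mul1g.
  by rewrite [in LHS]expgSr mulgA IHn expgSr !mulgA.
by rewrite mulgA C expgSr !mulgA -(mulgA _ (s j) (s j)) jj mulg1.
Qed.

(** Two letters that become adjacent and equal cancel: this is what happens in
    an alternating word extended by one letter on the left, when a letter other
    than the last is removed. *)
Lemma alt_deletion (G : groupType) (s : I -> G) i j k a1 l a2 :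
    (s i * s i = 1)%g -> (s j * s j = 1)%g ->
    alt i j k = a1 ++ l :: a2 -> a2 != [::] ->
  exists2 c, word_val s c = word_val s (j :: a1 ++ a2)
           & (size c).+2 = (size (j :: a1 ++ a2)).
Proof.
elim: k i j a1 => [|k IH] i j a1 ii jj; first by case: a1.
case: a1 => [|i' a1] /= [ei E] a20; last subst i'.
  case: k E {IH} => [|k] /= E; first by rewrite -E in a20.
  by exists (alt i j k); rewrite -E //= mulgA jj mul1g.
have [c cE cs] := IH j i a1 jj ii E a20.
by exists (j :: c); rewrite /= ?cE ?cs.
Qed.

End Words.

Section Exchange.
Context (W : groupType) (I : eqType) (s : I -> W).
Hypothesis s2 : forall i, (s i * s i = 1)%g.
Hypothesis gen : forall w, exists a, word_val s a = w.

Lemma ex_word w : exists k, `[< exists2 a, word_val s a = w & size a = k >].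
Proof. by have [a aw] := gen w; exists (size a); apply/asboolP; exists a. Qed.

Definition len w := ex_minn (ex_word w).

Lemma len_le a : (len (word_val s a) <= size a)%N.
Proof.
by rewrite /len; case: ex_minnP => k _; apply; apply/asboolP; exists a.
Qed.

Lemma reduced_word w : exists2 a, word_val s a = w & size a = len w.
Proof. by rewrite /len; case: ex_minnP => k /asboolP[a aw ak] _; exists a. Qed.

Lemma len_Ms i w : (len w <= (len (s i * w)%g).+1)%N.
Proof.
have [a aw <-] := reduced_word (s i * w)%g.
by have := len_le (i :: a); rewrite /= aw mulgA s2 mul1g.
Qed.

Hypothesis exchange : forall i a,
  (len (s i * word_val s a)%g <= len (word_val s a))%N ->
  exists a1 l a2, a = a1 ++ l :: a2 /\
    (s i * word_val s a = word_val s (a1 ++ a2))%g.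

(** If both [s i] and [s j] shorten [w], then [w] is divisible on the left by the
    longest element of the dihedral group that they generate.  Each exchange
    takes a letter away from the tail and lengthens the alternating head, until
    the letter comes from the end of the head: that is the braid relation. *)
Lemma dihedral_head w i j k a :
    word_val s (alt i j k ++ a) = w -> (k + size a)%N = len w ->
    (len (s i * w)%g < len w)%N -> (len (s j * w)%g < len w)%N ->
  exists m c, [/\ (0 < m)%N, word_val s (alt i j m ++ c) = w,
    word_val s (alt j i m ++ c) = w & (m + size c)%N = len w].
Proof.
have [n] := ubnP (size a); elim: n => // n IH in i j k a * => an E L di dj.
have [|a1 [l [a2 [Ea Ew]]]] := @exchange j (alt i j k ++ a).
  by rewrite E ltnW.
rewrite E in Ew.
have Ew' : w = (s j * word_val s (a1 ++ a2))%g by rewrite -Ew mulgA s2 mul1g.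
have [a1k|ka1] := ltnP (size a1) k.
  pose b := drop (size a1).+1 (alt i j k).
  have Ealt : alt i j k = a1 ++ l :: b.
    rewrite -[LHS](cat_take_drop (size a1).+1) -/b -cat_rcons; congr (_ ++ _).
    have := congr1 (take (size a1).+1) Ea.
    by rewrite takel_cat ?size_alt // -cat_rcons take_size_cat ?size_rcons.
  have Ea2 : a2 = b ++ a.
    move: Ea; rewrite Ealt -!catA /= => /eqP.
    by rewrite eqseq_cat // eqxx /= eqseq_cons eqxx => /eqP.
  case: (eqVneq b [::]) => [b0|bn0].
    exists k, a; split=> //; first by case: (k) a1k.
    have sa1 : k = (size a1).+1.
      by rewrite -(size_alt i j k) Ealt b0 size_cat addn1.
    have Ea1 : a1 = alt i j (size a1).
      by rewrite -take_alt -sa1 Ealt take_size_cat.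
    by rewrite Ew' Ea2 b0 /= sa1 /= -Ea1.
  have [c cE cs] := alt_deletion (s2 i) (s2 j) Ealt bn0.
  have := len_le (c ++ a).
  rewrite word_val_cat cE -word_val_cat /= -catA -Ea2 -Ew' -L size_cat.
  rewrite leq_add2r -(size_alt i j k) Ealt size_cat /=.
  by move: cs; rewrite /= size_cat addnS => -[<-]; rewrite ltnNge leqnSn.
pose a1' := drop k a1.
have Ea1 : a1 = alt i j k ++ a1'.
  rewrite -[LHS](cat_take_drop k) -/a1'; congr (_ ++ _).
  have := congr1 (take k) Ea.
  by rewrite take_size_cat ?size_alt // takel_cat.
have Ea' : a = a1' ++ l :: a2.
  by move: Ea; rewrite Ea1 -catA => /eqP; rewrite eqseq_cat // eqxx => /eqP.
have [|||m [c [m0 E1 E2 E3]]] := IH j i k.+1 (a1' ++ a2) _ _ _ dj di.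
- by move: an; rewrite Ea' !size_cat /= addnS ltnS.
- by rewrite /= catA -Ea1 Ew'.
- by rewrite -L Ea' !size_cat /= addnS addSnnS addnS.
by exists m, c.
Qed.

Section Lift.
Context (G : groupType) (t : I -> G).
Hypothesis t_rel :
  coxeter_relations (fun i j => group_order (s i * s j)%g) t.

(** The relation with [i = j] makes the images involutions as well. *)
Lemma t_invol i : (t i * t i = 1)%g.
Proof.
have := t_rel i i; rewrite s2.
by have /group_order_eq1-> : (1 : W)%g = 1%g by []; rewrite expg1.
Qed.

Lemma alt_lift i j m : word_val s (alt i j m) = word_val s (alt j i m) ->
  word_val t (alt i j m) = word_val t (alt j i m).
Proof.
case: m => // m E; rewrite word_val_alt ?t_invol //; move: E.
rewrite word_val_alt ?s2 // => /(canRL (mulgK _)); rewrite mulgV => E.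
have /dvdnP[q ->] := group_order_dvd (ltn0Sn m) E.
by rewrite mulnC expgnA t_rel expg1n mul1g.
Qed.

(** Matsumoto's theorem: two reduced words of one element differ by braid
    relations. *)
Lemma reduced_lift a b : word_val s a = word_val s b ->
  size a = len (word_val s a) -> size b = len (word_val s b) ->
  word_val t a = word_val t b.
Proof.
have [n] := ubnP (size a); elim: n => // n IH in a b *.
(* A tail of a reduced word is reduced. *)
have tailP i c : size (i :: c) = len (word_val s (i :: c)) ->
    size c = len (word_val s c).
  move=> /= ic; apply/eqP; rewrite eqn_leq len_le andbT -ltnS ic.
  by have := len_Ms i (s i * word_val s c)%g; rewrite mulgA s2 mul1g.
case: a => [|i a] an; case: b => [|j b] E La Lb //.
- by move: Lb; rewrite -E -La.
- by move: La; rewrite E -Lb.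
have La' := tailP _ _ La; have Lb' := tailP _ _ Lb.
have [ij|nij] := eqVneq i j.
  subst j; congr (_ * _)%g; apply: IH => //; exact: mulgI E.
set w := word_val s (i :: a) in E La.
have di : (len (s i * w)%g < len w)%N.
  by rewrite -La /w /= mulgA s2 mul1g ltnS len_le.
have dj : (len (s j * w)%g < len w)%N.
  by rewrite E -Lb /= mulgA s2 mul1g ltnS len_le.
have [m [c [m0 Ei Ej L]]] := @dihedral_head w i j 0 (i :: a) erefl La di dj.
have sub k l d : (size d < n)%N -> word_val s (k :: d) = w ->
    size (k :: d) = len w -> word_val s (alt k l m ++ c) = w ->
    word_val t (k :: d) = word_val t (alt k l m ++ c).
  move=> dn Ed Ld; case: m m0 L {Ei Ej} => // m _ L /= Ek.
  have Ed' : word_val s d = word_val s (alt l k m ++ c).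
    by apply: (@mulgI _ (s k)); rewrite Ek -Ed.
  congr (_ * _)%g; apply: IH => //; first by apply: (tailP k); rewrite Ed.
  by apply: (tailP k); rewrite /= Ek size_cat size_alt -L.
have ab : size a = size b by have := La; rewrite E -Lb => -[].
have Eij : word_val s (alt i j m) = word_val s (alt j i m).
  by apply: (@mulIg _ (word_val s c)); rewrite -!word_val_cat Ei Ej.
rewrite (sub i j a) // (sub j i b) //; last 2 first.
- by rewrite -ab.
- by rewrite Lb E.
by rewrite !word_val_cat (alt_lift Eij).
Qed.

(** The extension of [t] to [W]; by [reduced_lift] the choice of a reduced word
    does not matter. *)
Definition word_lift w := word_val t (projT1 (cid2 (reduced_word w))).

Lemma word_lift_reduced a : size a = len (word_val s a) ->
  word_lift (word_val s a) = word_val t a.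
Proof.
move=> La; rewrite /word_lift; case: cid2 => b /= E Lb.
by apply: reduced_lift; rewrite ?E.
Qed.

Lemma word_lift_Ms i w : word_lift (s i * w)%g = (t i * word_lift w)%g.
Proof.
have up v : (len v < len (s i * v)%g)%N ->
    word_lift (s i * v)%g = (t i * word_lift v)%g.
  have [a <- La] := reduced_word v => lt.
  rewrite (word_lift_reduced La) -[(s i * _)%g]/(word_val s (i :: a)).
  rewrite word_lift_reduced //.
  by apply/eqP; rewrite eqn_leq len_le /= La andbT.
have [|le] := ltnP (len w) (len (s i * w)%g); first exact: up.
have := up (s i * w)%g; rewrite mulgA s2 mul1g => -> //.
  by rewrite mulgA t_invol mul1g.
have [a Ea La] := reduced_word w; rewrite -Ea in le *.
have [a1 [l [a2 [aE ->]]]] := exchange le.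
rewrite Ea -La aE; apply: leq_ltn_trans (len_le _) _.
by rewrite !size_cat /= addnS.
Qed.

Lemma word_lift_morph : {morph word_lift : x y / (x * y)%g}.
Proof.
move=> x y; have [a <-] := gen x; elim: a => [|i a IH] /=.
  have /word_lift_reduced E1 : size ([::] : seq I) = len (word_val s [::]).
    by apply/esym/eqP; rewrite -leqn0 len_le.
  by rewrite mul1g [word_lift 1%g]E1 mul1g.
by rewrite -mulgA !word_lift_Ms IH mulgA.
Qed.

Lemma word_lift_gen i : word_lift (s i) = t i.
Proof.
have -> : s i = (s i * 1)%g by rewrite mulg1.
have lift1 : word_lift 1%g = 1%g.
  by apply: (@mulgI _ (word_lift 1%g)); rewrite -word_lift_morph !mulg1.
by rewrite word_lift_Ms lift1 mulg1.
Qed.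

End Lift.

(** The Coxeter matrix is read off from the orders of the products of two
    generators. *)
Lemma exchange_coxeter : injective s -> coxeter_group W.
Proof.
move=> s_inj; exists I, (fun i j => group_order (s i * s j)%g), s; split.
- have sV i : ((s i)^-1 = s i)%g by apply: mulg1_eq.
  split=> [i j|i j]; first by rewrite -group_orderV invgM !sV.
  rewrite group_order_eq1; split=> [/mulg1_eq|->]; last exact: s2.
  by rewrite sV => /s_inj.
- by move=> i j; apply: expg_order.
move=> G t t_rel; exists (word_lift t); split.
  by split; [exact: word_lift_morph | apply/funext => i; apply: word_lift_gen].
move=> h [hM hs]; apply/funext => w; have [a <-] := gen w.
have h1 : h 1%g = 1%g by apply: (@mulgI _ (h 1%g)); rewrite -hM !mulg1.
elim: a => [|i a IH] /=.
  have := word_lift_morph t_rel 1%g 1%g; rewrite mulg1 h1 => E.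
  by apply: (@mulgI _ (word_lift t 1%g)); rewrite -E mulg1.
by rewrite hM word_lift_morph // IH word_lift_gen // -hs.
Qed.

End Exchange.

(** [N w] stands for the set of reflections whose mirrors separate a base point
    from its image under [w]. *)
Lemma cocycle_coxeter (W : groupType) (I : eqType) (s : I -> W)
    (N : W -> W -> bool) :
    injective s -> (forall i, (s i * s i = 1)%g) ->
    (forall w, exists a, word_val s a = w) ->
    (forall x y t, N (x * y)%g t = N x t (+) N y (x^-1 * t * x)%g) ->
    (forall i t, N (s i) t = (t == s i)) ->
  coxeter_group W.
Proof.
move=> s_inj s2 gen NM Ns; apply: exchange_coxeter (s2) (gen) _ s_inj => i a.
have N1 t : N 1%g t = false.
  by have := NM 1%g 1%g t; rewrite mulg1 invg1 mul1g mulg1; case: (N 1%g t).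
have sV j : ((s j)^-1 = s j)%g by apply: mulg1_eq.
have strong t b : N (word_val s b) t -> exists b1 l b2,
    b = b1 ++ l :: b2 /\ (t * word_val s b = word_val s (b1 ++ b2))%g.
  elim: b t => [|j b IH] t /=; first by rewrite N1.
  rewrite NM Ns; have [->|_] /= := eqVneq t (s j).
    by move=> _; exists [::], j, b; rewrite mulgA s2 mul1g.
  move=> /IH[b1 [l [b2 [-> E]]]]; exists (j :: b1), l, b2; split=> //=.
  by rewrite -E sV !mulgA s2 mul1g.
case: (boolP (N (word_val s a) (s i))) => [/strong //|nN le].
have [b Eb Lb] := reduced_word gen (s i * word_val s a)%g.
have /strong[b1 [l [b2 [bE]]]] : N (word_val s b) (s i).
  by rewrite Eb NM Ns eqxx mulVg mul1g (negbTE nN).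
rewrite Eb mulgA s2 mul1g => E; exfalso.
move: le; rewrite leqNgt => /negP; apply.
rewrite -Lb bE E; apply: leq_ltn_trans (len_le gen _) _.
by rewrite !size_cat /= addnS.
Qed.

(** * Integral bilinear forms *)

Section FormTheory.
Context (R : comPzRingType) (n : nat) (A : 'M[R]_n).
Implicit Types x y z : 'rV[R]_n.

Lemma formDl x y z : form A (x + y) z = form A x z + form A y z.
Proof. by rewrite /form !mulmxDl mxE. Qed.

Lemma formDr x y z : form A z (x + y) = form A z x + form A z y.
Proof. by rewrite /form linearD mulmxDr mxE. Qed.

Lemma formZl a x y : form A (a *: x) y = a * form A x y.
Proof. by rewrite /form -!scalemxAl mxE. Qed.

Lemma formZr a x y : form A x (a *: y) = a * form A x y.
Proof. by rewrite /form linearZ /= -scalemxAr mxE. Qed.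

Lemma formNl x y : form A (- x) y = - form A x y.
Proof. by rewrite -scaleN1r formZl mulN1r. Qed.

Lemma formNr x y : form A x (- y) = - form A x y.
Proof. by rewrite -scaleN1r formZr mulN1r. Qed.

Lemma form0l y : form A 0 y = 0.
Proof. by rewrite /form !mul0mx mxE. Qed.

Lemma formC (As : A^T = A) x y : form A x y = form A y x.
Proof.
rewrite /form; have -> : (y *m A *m x^T) = (x *m A *m y^T)^T.
  by rewrite !trmx_mul trmxK As mulmxA.
by rewrite [RHS]mxE.
Qed.

Lemma qformZ a x : qform A (a *: x) = a ^+ 2 * qform A x.
Proof. by rewrite /qform formZl formZr mulrA expr2. Qed.

Lemma qformD (As : A^T = A) x y :
  qform A (x + y) = qform A x + 2 * form A x y + qform A y.
Proof. by rewrite /qform formDl !formDr (formC As y x); ring. Qed.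

End FormTheory.

Lemma form_mul (R : comPzRingType) m n (A : 'M[R]_n) (P : 'M[R]_(m, n)) x y :
  form A (x *m P) (y *m P) = form (P *m A *m P^T) x y.
Proof. by rewrite /form trmx_mul !mulmxA. Qed.

Lemma form_row (R : comPzRingType) m n (A : 'M[R]_n) (P : 'M[R]_(m, n)) i j :
  (P *m A *m P^T) i j = form A (row i P) (row j P).
Proof.
rewrite /form tr_row -row_mul !mxE.
by apply: eq_bigr => k _; rewrite !mxE.
Qed.

(** * Reduction of positive definite forms *)

Definition posdef n (G : 'M[int]_n) := forall x, x != 0 -> 0 < qform G x.

Section Posdef.
Context (n : nat) (G : 'M[int]_n).
Hypotheses (Gs : G^T = G) (Gp : posdef G).

Lemma posdef_ge0 x : 0 <= qform G x.
Proof. by have [->|/Gp/ltW//] := eqVneq x 0; rewrite /qform form0l. Qed.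

Lemma posdef_cauchy x y : form G x y ^+ 2 <= qform G x * qform G y.
Proof.
have [->|y0] := eqVneq y 0.
  by rewrite (formC Gs) /qform !form0l expr0n mulr0.
have := posdef_ge0 (qform G y *: x + (- form G x y) *: y).
rewrite qformD // !qformZ formZl formZr.
set a := qform G x; set b := qform G y; set c := form G x y.
have -> : b ^+ 2 * a + 2 * (b * (- c * c)) + (- c) ^+ 2 * b =
    b * (a * b - c ^+ 2).
  by ring.
by rewrite pmulr_rge0 ?Gp // subr_ge0.
Qed.

End Posdef.

Lemma posdef_congr m n (G : 'M[int]_n) (P : 'M[int]_(m, n)) :
  posdef G -> (forall x : 'rV_m, x *m P = 0 -> x = 0) -> posdef (P *m G *m P^T).
Proof.
move=> Gp Pinj x x0; rewrite /qform -form_mul; apply: Gp.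
by apply: contraNneq x0 => /Pinj ->.
Qed.

Lemma finite_bounded_mx m n (B : int) :
  finite_set [set M : 'M[int]_(m, n) | forall i j, `|M i j| <= B].
Proof.
pose f (N : 'M['I_(`|B| + `|B|).+1]_(m, n)) : 'M[int]_(m, n) :=
  \matrix_(i, j) ((N i j)%:Z - `|B|%N%:Z).
have F : finite_set (f @` setT) by apply: finite_image; apply: finite_finset.
apply: sub_finite_set F => M MB.
exists (\matrix_(i, j) inord (absz (M i j + (absz B)%:Z))) => //.
apply/matrixP => i j; rewrite !mxE inordK; have := MB i j; lia.
Qed.

(** Cramer's rule writes the coordinates of [y] as pairings with the columns of
    the adjugate matrix. *)
Lemma posdef_ball_bounded n (G : 'M[int]_n) (c : int) :
  G^T = G -> posdef G -> \det G != 0 ->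
  exists B : int, forall y, qform G y <= c -> forall i, `|y 0 i| <= B.
Proof.
move=> Gs Gp d0; pose z i := (col i (\adj G))^T.
exists (`|c| * \sum_i qform G (z i)) => y yc i.
have E : form G y (z i) = y 0 i * \det G.
  rewrite /form trmxK colE !mulmxA -(mulmxA y) mul_mx_adj mul_mx_scalar.
  by rewrite -scalemxAl -colE !mxE mulrC.
have := posdef_cauchy Gs Gp y (z i).
rewrite E exprMn => H.
have d1 : 1 <= \det G ^+ 2 by move: d0; set d := \det G; nia.
have z0 := posdef_ge0 Gp.
have zi : qform G (z i) <= \sum_i qform G (z i).
  by rewrite (bigD1 i) //= lerDl sumr_ge0.
have h1 : `|y 0 i| <= y 0 i ^+ 2 by nia.
apply: (le_trans h1); apply: (@le_trans _ _ (y 0 i ^+ 2 * \det G ^+ 2)).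
  by rewrite ler_peMr // sqr_ge0.
apply: (le_trans H); apply: ler_pM => //; rewrite (le_trans yc) // ler_norm //.
Qed.

Lemma centered_remainder (a b : int) :
  0 < a -> exists k : int, 4 * (a * k + b) ^+ 2 <= a ^+ 2.
Proof.
move=> a0; exists (- ((2 * b + a) %/ (2 * a))%Z).
have E := divz_eq (2 * b + a) (2 * a).
have r0 := modz_ge0 (2 * b + a) (_ : 2 * a != 0).
have r1 := ltz_pmod (2 * b + a) (_ : 0 < 2 * a).
move: (((2 * b + a) %/ (2 * a))%Z) (((2 * b + a) %% (2 * a))%Z) E r0 r1.
move=> q r E r0 r1.
have {}r0 : 0 <= r by apply: r0; lia.
have {}r1 : r < 2 * a by apply: r1; lia.
have -> : 4 * (a * - q + b) ^+ 2 = (r - a) ^+ 2.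
  have -> : r = 2 * b + a - q * (2 * a) by rewrite E; ring.
  by ring.
nia.
Qed.

Section ShortVectors.
Context (n : nat).

Lemma min_vector (G : 'M[int]_n.+1) : posdef G ->
  exists2 v, v != 0 & forall w, w != 0 -> qform G v <= qform G w.
Proof.
move=> Gp.
have ex : exists k, `[< exists2 v, v != 0 & absz (qform G v) = k >].
  exists (absz (qform G (const_mx 1))); apply/asboolP; exists (const_mx 1) => //.
  by apply/eqP => /rowP/(_ 0); rewrite !mxE.
have [k /asboolP[v v0 <-] kmin] := ex_minnP ex.
exists v => // w w0.
have := kmin _ (introT (asboolP _) (ex_intro2 _ _ w w0 erefl)).
by have := Gp _ v0; have := Gp _ w0; lia.
Qed.

(** The Smith normal form of a minimal vector completes it, up to sign, to a
    basis. *)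
Lemma min_basis (G : 'M[int]_n.+1) : posdef G ->
  exists2 P, P \in unitmx & forall w, w != 0 -> qform G (row 0 P) <= qform G w.
Proof.
move=> Gp; have [v v0 vmin] := min_vector Gp.
have [L _ [P uP [d _ vE]]] := int_Smith_normal_form v.
exists P => // w /vmin; apply: le_trans.
have {}vE : v = (L 0 0 * d`_0) *: row 0 P.
  rewrite vE [L]mx11_scalar mul_scalar_mx -scalemxAl; apply/rowP => j.
  rewrite !mxE (bigD1 ord0) //= big1 ?addr0 => [|k k0].
    by rewrite !mxE mulrA.
  rewrite !mxE; have -> : (nat_of_ord (0 : 'I_1) == k) = false.
    by apply/negbTE; rewrite eq_sym; exact: k0.
  by rewrite mulr0n mul0r.
move: v0; rewrite vE qformZ; set c := L 0 0 * _ => c0.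
have {}c0 : c != 0 by apply: contraNneq c0 => ->; rewrite scale0r.
rewrite ler_peMl ?posdef_ge0 //; nia.
Qed.

End ShortVectors.

(** Completing the square against the first basis vector turns a form [M] into
    [(a x + b y) ^ 2 + (schur M) y], up to the factor [a]; the factor keeps the
    complement integral. *)
Definition schur n (M : 'M[int]_(1 + n)) : 'M[int]_n :=
  M 0 0 *: drsubmx M - (ursubmx M)^T *m ursubmx M.

Section Schur.
Context (n : nat) (M : 'M[int]_(1 + n)).
Hypothesis Ms : M^T = M.

Lemma schur_sym : (schur M)^T = schur M.
Proof.
rewrite /schur linearB linearZ /= trmx_mul trmxK; congr (_ *: _ - _).
by rewrite -[in RHS]Ms trmx_drsub.
Qed.

Lemma ulsubmx_scalar : ulsubmx M = (M 0 0)%:M.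
Proof. by rewrite [LHS]mx11_scalar !mxE; congr (M _ _)%:M; apply: val_inj. Qed.

Lemma schur_block :
  M = block_mx (M 0 0)%:M (ursubmx M) (ursubmx M)^T (drsubmx M).
Proof. by rewrite -[LHS]submxK ulsubmx_scalar trmx_ursub Ms. Qed.

Lemma qform_schur k y :
  M 0 0 * qform M (row_mx k%:M y) =
  (M 0 0 * k + (ursubmx M *m y^T) 0 0) ^+ 2 + qform (schur M) y.
Proof.
set a := M 0 0; set b := ursubmx M; set C := drsubmx M.
have ME : M = block_mx a%:M b b^T C := schur_block.
have [c bE] : exists c : int, b *m y^T = c%:M by eexists; apply: mx11_scalar.
have -> : (b *m y^T) 0 0 = c by rewrite bE mxE.
have -> : qform M (row_mx k%:M y) =
    a * k ^+ 2 + 2 * k * c + form C y y.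
  rewrite /qform /form {1}ME mul_row_block tr_row_mx mul_row_col.
  rewrite !mulmxDl tr_scalar_mx -!scalar_mxM -!mulmxA !mul_scalar_mx.
  have -> : y *m (b^T *m k%:M) = (k * c)%:M.
    rewrite mul_mx_scalar -scalemxAr -[y in LHS]trmxK -trmx_mul.
    by rewrite bE tr_scalar_mx scale_scalar_mx.
  rewrite bE; move: (y *m (C *m y^T)) => D.
  by rewrite !mxE eqxx !mulr1n; ring.
have -> : qform (schur M) y = a * form C y y - c ^+ 2.
  rewrite /qform /form /schur -/a -/b -/C mulmxBr mulmxBl -scalemxAr -scalemxAl.
  rewrite mulmxA -mulmxA.
  have -> : y *m b^T = (b *m y^T)^T by rewrite trmx_mul trmxK.
  rewrite bE tr_scalar_mx -scalar_mxM; move: (y *m (C *m y^T)) => D.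
  by rewrite !mxE eqxx !mulr1n expr2.
by ring.
Qed.

Lemma det_schur : M 0 0 * \det (schur M) = M 0 0 ^+ n * \det M.
Proof.
set a := M 0 0; set b := ursubmx M; set C := drsubmx M.
have ME : M = block_mx a%:M b b^T C := schur_block.
have : block_mx (1%:M : 'M_1) 0 (- b^T) a%:M *m M = block_mx a%:M b 0 (schur M).
  rewrite [in LHS]ME mulmx_block !mul1mx !mul0mx !addr0 mulNmx mul_mx_scalar mulNmx.
  by rewrite /schur -/a -/b -/C !mul_scalar_mx addNr addrC.
move=> /(congr1 (fun X : 'M_(1 + n) => \det X)).
by rewrite det_mulmx det_lblock det_ublock !det_scalar !expr1 mul1r => ->.
Qed.

Hypothesis Mp : posdef M.

Lemma schur_corner_gt0 : 0 < M 0 0.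
Proof.
have -> : M 0 0 = qform M (row_mx 1%:M 0).
  rewrite /qform /form -[in RHS](submxK M) mul_row_block tr_row_mx mul_row_col.
  rewrite trmx0 mulmx0 addr0 mul1mx mul0mx addr0 trmx1 mulmx1 ulsubmx_scalar.
  by rewrite [RHS]mxE eqxx.
apply: Mp; apply/eqP => /rowP/(_ 0); rewrite mxE.
by case: splitP => // j; rewrite !ord1 !mxE.
Qed.

(** At the integral vector [(- b y, a y)] the square in [qform_schur] vanishes, and
    what remains is a positive multiple of the complement at [y]. *)
Lemma schur_posdef : posdef (schur M).
Proof.
move=> y y0; have a0 := schur_corner_gt0.
set b := (ursubmx M *m y^T) 0 0.
have : 0 < M 0 0 * qform M (row_mx (- b)%:M (M 0 0 *: y)).
  rewrite pmulr_rgt0 //; apply: Mp; apply: contra y0 => /eqP E.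
  have := congr1 rsubmx E; rewrite row_mxKr linear0 => /eqP.
  by rewrite scalemx_eq0 gt_eqF.
rewrite qform_schur linearZ /= -scalemxAr mxE -/b qformZ.
have -> : M 0 0 * - b + M 0 0 * b = 0 by ring.
by rewrite expr0n add0r pmulr_rgt0 // exprn_gt0.
Qed.

End Schur.

Lemma form_congr_sym m n (G : 'M[int]_n) (P : 'M[int]_(m, n)) :
  G^T = G -> (P *m G *m P^T)^T = P *m G *m P^T.
Proof. by move=> Gs; rewrite !trmx_mul trmxK Gs mulmxA. Qed.

Lemma norm_det_unit n (P : 'M[int]_n) : P \in unitmx -> `|\det P| = 1.
Proof. by rewrite unitmxE => /orP[/eqP->|/eqP->]. Qed.

Lemma norm_det_congr n (G P : 'M[int]_n) : P \in unitmx ->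
  `|\det (P *m G *m P^T)| = `|\det G|.
Proof.
by move=> uP; rewrite !det_mulmx det_tr !normrM (norm_det_unit uP) mul1r mulr1.
Qed.

Lemma unitmx_inj0 n (P : 'M[int]_n) : P \in unitmx ->
  forall x : 'rV_n, x *m P = 0 -> x = 0.
Proof. by move=> uP x xP; rewrite -[x](mulmxK uP) xP mul0mx. Qed.

(** The common part of the two reduction steps below: a basis that starts with a
    minimal vector, whose norm is [a]. *)
Lemma min_basis_schur n (G : 'M[int]_n.+1) : G^T = G -> posdef G ->
  exists (P : 'M[int]_(1 + n)) (a : int), let M := P *m G *m P^T in
    [/\ P \in unitmx, [/\ M^T = M, posdef M, M 0 0 = a & 0 < a],
        forall w : 'rV_(1 + n), w != 0 -> a <= qform M w &
        a * `|\det (schur M)| = a ^+ n * `|\det G|].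
Proof.
move=> Gs Gp; have [P uP Pmin] := min_basis Gp.
have Mp : posdef (P *m G *m P^T) by apply: posdef_congr (unitmx_inj0 uP).
have Ms := form_congr_sym P Gs.
exists P, ((P *m G *m P^T) 0 0); split=> //.
- by split=> //; apply: schur_corner_gt0.
- move=> w w0; rewrite form_row /qform -form_mul; apply: Pmin.
  by apply: contraNneq w0 => /(unitmx_inj0 uP) ->.
have a0 := schur_corner_gt0 Mp.
rewrite -(norm_det_congr G uP); have := congr1 Num.norm (det_schur Ms).
by rewrite !normrM normrX !(gtr0_norm a0).
Qed.

(** Hermite's inequality.  Lifting a short vector [y] of the Schur complement
    with a remainder of size at most [a / 2] gives a vector that is no shorter
    than [a], so that [3 a ^ 2 <= 4 (schur M) y]. *)
Lemma hermite n : exists2 K : int, 0 <= K &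
  forall G : 'M[int]_n.+1, G^T = G -> posdef G ->
  exists2 v, v != 0 & qform G v ^+ n.+1 <= K * `|\det G|.
Proof.
elim: n => [|n [K K0 IH]].
  exists 1 => // G _ Gp; exists 1%:M.
    by apply/eqP => /rowP/(_ 0); rewrite !mxE.
  by rewrite /qform /form trmx1 mulmx1 mul1mx expr1 mul1r det_mx11 ler_norm.
exists (4 ^+ n.+1 * K) => [|G Gs Gp]; first by rewrite mulr_ge0 ?exprn_ge0.
have [P [a /= [uP [Ms Mp Ma a0] amin adet]]] := min_basis_schur Gs Gp.
set M := P *m G *m P^T in Ms Mp Ma amin adet.
have [y y0 yK] := IH _ (schur_sym Ms) (schur_posdef Ms Mp).
have [k ka] := centered_remainder ((ursubmx M *m y^T) 0 0) a0.
have z0 : row_mx k%:M y != 0.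
  by apply: contraNneq y0 => /(congr1 rsubmx); rewrite row_mxKr linear0 => ->.
exists (row 0 P).
  apply/eqP => /(congr1 (mulmx^~ (invmx P))).
  by rewrite mul0mx -row_mul mulmxV // => /rowP/(_ 0); rewrite !mxE.
have -> : qform G (row 0 P) = a by rewrite -Ma form_row.
have aq : a ^+ 2 <= 4 * qform (schur M) y.
  have := qform_schur Ms k y; rewrite Ma => E.
  have : a * a <= a * qform M (row_mx k%:M y) by rewrite ler_pM2l // amin.
  by rewrite E; move: ka; set t := (_ + _) ^+ 2; set q := qform (schur M) y; nia.
have a20 : 0 <= a ^+ 2 by rewrite sqr_ge0.
have an0 : 0 < a ^+ n.+1 by rewrite exprn_gt0.
have H : (a ^+ 2) ^+ n.+1 <= 4 ^+ n.+1 * (K * `|\det (schur M)|).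
  apply: le_trans (_ : (4 * qform (schur M) y) ^+ n.+1 <= _).
    by apply: lerXn2r => //; rewrite ?nnegrE // (le_trans a20).
  by rewrite exprMn ler_pM2l // exprn_gt0.
rewrite -(ler_pM2l an0) [leRHS]mulrC.
have -> : a ^+ n.+1 * a ^+ n.+2 = (a ^+ 2) ^+ n.+1 * a.
  by rewrite -exprD -exprM -exprSr; congr (_ ^+ _); lia.
apply: le_trans (_ : 4 ^+ n.+1 * (K * `|\det (schur M)|) * a <= _).
  by rewrite ler_pM2r.
have -> : 4 ^+ n.+1 * (K * `|\det (schur M)|) * a =
  4 ^+ n.+1 * K * (a * `|\det (schur M)|) by ring.
by rewrite adet mulrA mulrAC.
Qed.

(** Reduction theory: the determinant of a definite lattice bounds the norms of
    the vectors of some basis.  In the inductive step a reduced basis of the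
    Schur complement is lifted, again with small remainders. *)
Lemma bounded_basis n (d : int) : exists B : int,
  forall G : 'M[int]_n, G^T = G -> posdef G -> `|\det G| <= d ->
  exists2 P, P \in unitmx & forall i, qform G (row i P) <= B.
Proof.
elim: n d => [|n IH] d.
  by exists 0 => G _ _ _; exists 1%:M; [rewrite unitmx1 | case].
have [K K0 KP] := hermite n.
have [B BP] := IH ((K * d) ^+ n * d).
exists ((K * d) ^+ 2 + K * d + `|B|) => G Gs Gp dG.
have [P [a /= [uP [Ms Mp Ma a0] amin adet]]] := min_basis_schur Gs Gp.
set M := P *m G *m P^T in Ms Mp Ma amin adet.
have aK : a <= K * d.
  have [v v0 vK] := KP G Gs Gp.
  have av : a <= qform G v.
    have := amin (v *m invmx P); rewrite /qform -form_mul mulmxKV //; apply.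
    by apply: contraNneq v0 => /unitmx_inj0->; rewrite ?unitmx_inv.
  apply: le_trans (_ : a ^+ n.+1 <= _); first by rewrite ler_eXnr //; lia.
  apply: le_trans (_ : qform G v ^+ n.+1 <= _).
    by apply: lerXn2r; rewrite ?nnegrE ?(ltW a0) // (le_trans (ltW a0)).
  by apply: le_trans vK _; rewrite ler_wpM2l.
have [Q uQ QB] : exists2 Q, Q \in unitmx &
    forall i, qform (schur M) (row i Q) <= B.
  apply: BP; [exact: schur_sym | exact: schur_posdef | ].
  apply: le_trans (_ : a * `|\det (schur M)| <= _).
    by rewrite ler_peMl //; lia.
  rewrite adet; apply: ler_pM; rewrite ?exprn_ge0 ?(ltW a0) //.
  by apply: lerXn2r; rewrite ?nnegrE ?(le_trans (ltW a0)) // ltW.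
have ex_k i := centered_remainder ((ursubmx M *m (row i Q)^T) 0 0) a0.
pose k : 'cV[int]_n := \col_i projT1 (cid (ex_k i)).
have kP i : 4 * (a * k i 0 + (ursubmx M *m (row i Q)^T) 0 0) ^+ 2 <= a ^+ 2.
  by rewrite mxE; case: cid.
pose S : 'M[int]_(1 + n) := block_mx 1%:M 0 k Q.
have uS : S \in unitmx.
  by rewrite unitmxE /S det_lblock det1 mul1r -unitmxE.
exists (S *m P) => [|i]; first by rewrite unitmx_mul uS.
rewrite row_mul /qform form_mul -/M -/(qform M _).
have a2 : a ^+ 2 <= (K * d) ^+ 2.
  by apply: lerXn2r; rewrite ?nnegrE ?(le_trans (ltW a0)) // ltW.
have qa l y : qform M (row_mx l%:M y) <= a * qform M (row_mx l%:M y).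
  by rewrite ler_peMl ?posdef_ge0 //; lia.
case: (@split_ordP 1 n i) => [i0 ->|{}i ->].
  have -> : row (lshift n i0) S = row_mx 1%:M 0.
    by rewrite rowKu row_row_mx row0 [row i0 _]mx11_scalar !mxE !ord1 eqxx.
  apply: le_trans (qa 1 0) _; rewrite -Ma (qform_schur Ms) Ma.
  rewrite trmx0 mulmx0 mxE /qform form0l mulr1 !addr0.
  by move: a2 (le_trans (ltW a0) aK); lia.
have -> : row (rshift 1 i) S = row_mx (k i 0)%:M (row i Q).
  by rewrite rowKd row_row_mx [row i k]mx11_scalar !mxE.
apply: le_trans (qa _ _) _; rewrite -Ma (qform_schur Ms) Ma.
move: a2 (kP i) (QB i) (le_trans (ltW a0) aK).
by set t := (_ + _) ^+ 2; set q := qform _ _; lia.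
Qed.

(** * Lorentzian lattices *)

(** Stated by its consequence for orthogonal complements, so that the argument
    can stay within the integers. *)
Definition lorentzian n (A : 'M[int]_n) := forall p y : 'rV[int]_n,
  qform A p < 0 -> form A p y = 0 -> y != 0 -> 0 < qform A y.

Lemma form_intr (R : comPzRingType) n (A : 'M[int]_n) x y :
  form (map_mx intr A : 'M[R]_n) (map_mx intr x) (map_mx intr y) =
  (form A x y)%:~R.
Proof. by rewrite /form map_trmx -!map_mxM mxE. Qed.

(** If [y] had norm at most 0, it would span with [p] a plane on which the form is
    nonpositive; this plane meets the hyperplane spanned by the positive
    directions. *)
Lemma signature_lorentzian (R : realFieldType) n (A : 'M[int]_n) :
  A^T = A -> has_signature (map_mx intr A : 'M[R]_n) n.-1 1 -> lorentzian A.
Proof.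
set B : 'M[R]_n := map_mx _ A.
move=> As [P [d [uP Pd npos nneg]]] p y p0 py y0.
have Bs : B^T = B by rewrite /B map_trmx As.
have /cards1P[i0 Ei0] : #|[set i | d 0 i < 0]%SET| == 1%N by apply/eqP.
have di0 : d 0 i0 < 0 by have := set11 i0; rewrite -Ei0 inE.
have dpos i : i != i0 -> 0 < d 0 i.
  move=> ii0; have : [set i | 0 < d 0 i]%SET == (~: [set i0])%SET.
    rewrite eqEcard cardsC1 card_ord npos leqnn andbT; apply/fintype.subsetP => j.
    by rewrite !inE; apply: contraTneq => ->; rewrite -leNgt ltW.
  by move=> /eqP/setP/(_ i); rewrite !inE ii0.
have qE x : qform B (x *m P) = \sum_i d 0 i * x 0 i ^+ 2.
  rewrite /qform form_mul Pd /form mul_mx_diag mxE; apply: eq_bigr => i _.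
  by rewrite !mxE mulrAC mulrC.
have ge0 (x : 'rV[R]_n) i : x 0 i0 = 0 -> 0 <= d 0 i * x 0 i ^+ 2.
  move=> x0; have [->|/dpos/ltW di] := eqVneq i i0.
    by rewrite x0 expr0n mulr0.
  by rewrite mulr_ge0 ?sqr_ge0.
have qpos (x : 'rV[R]_n) : x 0 i0 = 0 -> 0 <= qform B (x *m P).
  by move=> x0; rewrite qE sumr_ge0 // => i _; apply: ge0.
have qdef (x : 'rV[R]_n) : x 0 i0 = 0 -> qform B (x *m P) <= 0 -> x = 0.
  move=> x0 qx; have /eqP : qform B (x *m P) = 0.
    by apply/eqP; rewrite eq_le qx qpos.
  rewrite qE psumr_eq0 => [/allP zero|i _]; last exact: ge0.
  apply/rowP => i; rewrite mxE; have [->//|ii0] := eqVneq i i0.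
  have /= := zero i (mem_index_enum _).
  by rewrite mulf_eq0 gt_eqF ?dpos //= sqrf_eq0 => /eqP.
pose x' : 'rV[R]_n := map_mx intr p *m invmx P.
pose y' : 'rV[R]_n := map_mx intr y *m invmx P.
have x'P : x' *m P = map_mx intr p by rewrite mulmxKV.
have y'P : y' *m P = map_mx intr y by rewrite mulmxKV.
have qx : qform B (x' *m P) < 0 by rewrite x'P /qform form_intr ltrz0.
have [qy|//] := lerP (qform A y) 0.
have {}qy : qform B (y' *m P) <= 0 by rewrite y'P /qform form_intr lerz0.
have fxy : form B (x' *m P) (y' *m P) = 0 by rewrite x'P y'P form_intr py.
(* The vector [z] avoids the negative direction, so its norm is nonnegative. *)
pose z := y' 0 i0 *: x' - x' 0 i0 *: y'.
have : 0 <= qform B (z *m P) by apply: qpos; rewrite !mxE mulrC subrr.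
have -> : qform B (z *m P) = y' 0 i0 ^+ 2 * qform B (x' *m P) +
    x' 0 i0 ^+ 2 * qform B (y' *m P).
  rewrite mulmxBl -!scalemxAl qformD // /qform formNr formNl formNr !formZl !formZr.
  by rewrite fxy; ring.
move=> qz; have y'0 : y' 0 i0 = 0.
  apply/eqP; rewrite -sqrf_eq0 eq_le sqr_ge0 andbT -(ler_nM2r qx) mul0r.
  rewrite -(lerD2r (x' 0 i0 ^+ 2 * qform B (y' *m P))) add0r.
  by rewrite (le_trans _ qz) // mulr_ge0_le0 ?sqr_ge0.
case/eqP: y0; apply/rowP => i; apply/eqP; rewrite mxE -(intr_eq0 R).
have : map_mx intr y = 0 :> 'rV[R]_n by rewrite -y'P (qdef y') ?mul0mx.
by move=> /rowP/(_ i); rewrite !mxE => ->.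
Qed.

(** For [u] of norm -2 this changes the sign of the form along [u] and keeps it on
    the orthogonal complement of [u]. *)
Definition majorant n (A : 'M[int]_n) (u : 'rV[int]_n) : 'M[int]_n :=
  A + (A *m u^T) *m (u *m A).

Section Majorant.
Context (n : nat) (A : 'M[int]_n) (u : 'rV[int]_n).
Hypotheses (As : A^T = A) (Al : lorentzian A) (u2 : qform A u = - 2).

Lemma form_majorant x y :
  form (majorant A u) x y = form A x y + form A u x * form A u y.
Proof.
rewrite /majorant {1}/form mulmxDr mulmxDl mxE; congr (_ + _).
rewrite (mulmxA x) -(mulmxA _ _ y^T).
have -> : x *m (A *m u^T) = (form A u x)%:M.
  by rewrite mulmxA [LHS]mx11_scalar -/(form A x u) formC.
by rewrite mul_scalar_mx mxE.
Qed.

Lemma qform_majorant x : qform (majorant A u) x = qform A x + form A u x ^+ 2.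
Proof. by rewrite /qform form_majorant expr2. Qed.

Lemma majorant_sym : (majorant A u)^T = majorant A u.
Proof. by rewrite /majorant linearD /= !trmx_mul trmxK As. Qed.

Lemma majorant_posdef : posdef (majorant A u).
Proof.
move=> y y0; rewrite qform_majorant.
pose z := 2 *: y + form A u y *: u.
have uz : form A u z = 0.
  by rewrite formDr !formZr -/(qform A u) u2; ring.
have qz : qform A z = 4 * qform A y + 2 * form A u y ^+ 2.
  rewrite qformD // !qformZ formZl formZr u2 (formC As y u). ring.
have [z0|/(Al _ uz)] := eqVneq z 0; last by rewrite u2 qz; nia.
have uy : form A u y != 0.
  apply: contra_neq y0 => uy; move: z0; rewrite /z uy scale0r addr0 => /eqP.
  by rewrite scalemx_eq0 => /orP[|/eqP].
by move: qz; rewrite z0 {1}/qform form0l; nia.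
Qed.

(** The majorant is [A] times the matrix of the reflection in [u], an involution. *)
Lemma norm_det_majorant : `|\det (majorant A u)| = `|\det A|.
Proof.
have -> : majorant A u = A *m (1%:M + u^T *m (u *m A)).
  by rewrite /majorant mulmxDr mulmx1 !mulmxA.
pose X := u^T *m (u *m A); rewrite det_mulmx normrM -/X.
have XX : X *m X = (- 2) *: X.
  rewrite /X -mulmxA; have -> : u *m A *m (u^T *m (u *m A)) = (- 2) *: (u *m A).
    rewrite mulmxA [u *m A *m u^T]mx11_scalar -/(form A u u) -/(qform A u) u2.
    by rewrite mul_scalar_mx.
  by rewrite -scalemxAr.
have MM : (1%:M + X) *m (1%:M + X) = 1%:M.
  rewrite mulmxDl mul1mx mulmxDr mulmx1 XX -addrA.
  by rewrite scaleNr scaler_nat mulr2n (addrA X) subrr addr0.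
by rewrite [X in _ * X]norm_det_unit ?mulr1 //; case/mulmx1_unit: MM.
Qed.

Lemma majorant_ball_bounded c : \det A != 0 ->
  exists B : int, forall y, qform (majorant A u) y <= c ->
    forall i, `|y 0 i| <= B.
Proof.
move=> dA; apply: posdef_ball_bounded majorant_sym majorant_posdef _.
by rewrite -normr_eq0 norm_det_majorant normr_eq0.
Qed.

End Majorant.

Lemma form_nondeg n (A : 'M[int]_n) e : \det A != 0 -> e != 0 ->
  exists z, form A e z != 0.
Proof.
move=> dA e0; have [i ei] : exists i, e 0 i != 0.
  apply: contrapT => H; case/eqP: e0; apply/rowP => i; rewrite mxE.
  by apply/eqP; apply: contrapT => /negP ei; apply: H; exists i.
exists (col i (\adj A))^T.
rewrite /form trmxK colE !mulmxA -(mulmxA e) mul_mx_adj mul_mx_scalar.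
by rewrite -scalemxAl -colE !mxE mulf_neq0.
Qed.

(** Hyperplanes are treated one by one; a large multiple of the vector found so far
    is corrected by one that is off the new hyperplane. *)
Lemma avoid_hyperplanes n (A : 'M[int]_n) (s : seq 'rV[int]_n) :
  \det A != 0 -> exists z, forall e, e \in s -> e != 0 -> form A e z != 0.
Proof.
move=> dA; elim: s => [|f s [z zP]]; first by exists 0.
have [f0|f0] := eqVneq f 0.
  by exists z => e; rewrite inE => /orP[/eqP->|/zP//]; rewrite f0 eqxx.
have [fz|fz] := eqVneq (form A f z) 0; last first.
  by exists z => e; rewrite inE => /orP[/eqP->|/zP].
have [w fw] := form_nondeg dA f0.
pose K := 1 + \sum_(e <- s) `|form A e w|.
exists (K *: z + w) => e; rewrite inE formDr formZr => /orP[/eqP-> _|es e0].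
  by rewrite fz mulr0 add0r.
have eK : `|form A e w| < K.
  have : `|form A e w| <= \sum_(e <- s) `|form A e w|.
    by rewrite (big_rem e) //= lerDl sumr_ge0.
  by rewrite /K; lia.
have : K <= `|K * form A e z|.
  by rewrite normrM gtr0_norm ?ler_peMr; have := zP e es e0; lia.
by rewrite addr_eq0; case: eqP => // ->; rewrite normrN leNgt eK.
Qed.

(** The vector [u] itself may lie on finitely many mirrors; a large multiple
    of [u] plus a small correction avoids them all. *)
Lemma generic_point n (A : 'M[int]_n) u : A^T = A -> lorentzian A ->
    \det A != 0 -> qform A u = - 2 ->
  exists2 p, qform A p < 0 & forall e, qform A e = 2 -> form A e p != 0.
Proof.
move=> As Al dA u2.
set G := majorant A u.
have [B BP] := majorant_ball_bounded As Al u2 2 dA.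
have /finite_seqP[s sE] := finite_bounded_mx 1 n B.
have [z zs] := avoid_hyperplanes s dA.
have Gp : posdef G := majorant_posdef As Al u2.
pose g := qform G z; have g0 : 0 <= g := posdef_ge0 Gp z.
(* [N] exceeds the slope of [e |-> (e, z)] against [e |-> (e, u)] on the vectors of
   norm 2 that are not orthogonal to [u]. *)
pose N := 1 + `|form A u z| + 3 * g.
exists (N *: u + z).
  rewrite qformD // qformZ u2 formZl.
  have : qform A z <= g by rewrite /g qform_majorant // lerDl sqr_ge0.
  have N1 : 1 <= N by rewrite /N; lia.
  have Nw : 1 + 3 * g <= N - form A u z by rewrite /N; lia.
  have : N - form A u z <= N * (N - form A u z) by rewrite ler_peMl //; lia.
  have arith (a b c d : int) : 0 <= c -> 1 + 3 * c <= a - b -> d <= c ->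
    a * - 2 + 2 * b + d < 0 by lia.
  rewrite mulrBr -expr2 => /(le_trans Nw); exact: arith.
move=> e e2; rewrite formDr formZr.
have [eu|eu] := eqVneq (form A e u) 0.
  rewrite eu mulr0 add0r; apply: zs.
    suff: [set` s] e by []. 
    rewrite -sE /= => k i; rewrite ord1; apply: BP.
    by rewrite qform_majorant // e2 (formC As) eu.
  by apply: contra_eq_neq e2 => ->; rewrite /qform form0l.
have := posdef_cauchy (majorant_sym u As) Gp e z.
rewrite -/g qform_majorant // form_majorant // e2 (formC As u e).
set x := form A e u in eu *; set y := form A e z; set w := form A u z.
move=> H; apply/eqP => E.
have x1 : 0 < x ^+ 2 by rewrite exprn_even_gt0.
have xy : (y + x * w) ^+ 2 = (N - w) ^+ 2 * x ^+ 2.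
  have -> : y = - (N * x) by apply/eqP; rewrite -addr_eq0 addrC E.
  by ring.
have Nw : (1 + 3 * g) ^+ 2 <= (N - w) ^+ 2.
  by apply: lerXn2r; rewrite ?nnegrE /N; lia.
have : (1 + 3 * g) ^+ 2 * x ^+ 2 <= (2 + x ^+ 2) * g.
  by rewrite (le_trans _ H) // xy ler_pM2r.
have arith (X c : int) : 0 < X -> 0 <= c -> (2 + X) * c < (1 + 3 * c) ^+ 2 * X.
  move=> X0 c0; have cX : c <= c * X by rewrite ler_peMr //; lia.
  have ccX : 0 <= c * (c * X) by rewrite !mulr_ge0 // ltW.
  have -> : (1 + 3 * c) ^+ 2 * X = X + 6 * (c * X) + 9 * (c * (c * X)) by ring.
  have -> : (2 + X) * c = 2 * c + c * X by ring.
  by lia.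
by rewrite leNgt arith.
Qed.

(** * Isometries and reflections *)

Section Isometries.
Context (n : nat) (A : 'M[int]_n).
Implicit Types (g h : isom A) (v x y : 'rV[int]_n).

Lemma isom_ext g h :
  (forall y, y *m isom_mx g = y *m isom_mx h) -> g = h.
Proof.
move=> gh; apply: val_inj; apply/row_matrixP => i.
by rewrite /= !rowE gh.
Qed.

Lemma mul_isomM y g h : y *m isom_mx (g * h)%g = y *m isom_mx g *m isom_mx h.
Proof. by rewrite -mulmxA. Qed.

Lemma mul_isom1 y : y *m isom_mx (1%g : isom A) = y.
Proof. exact: mulmx1. Qed.

Lemma mul_isomVK g y : y *m isom_mx g^-1%g *m isom_mx g = y.
Proof. by rewrite -mul_isomM mulVg mul_isom1. Qed.

Lemma form_isom g x y : form A (x *m isom_mx g) (y *m isom_mx g) = form A x y.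
Proof. by rewrite form_mul; case: g => g /= /andP[_ /eqP->]. Qed.

Lemma qform_isom g x : qform A (x *m isom_mx g) = qform A x.
Proof. exact: form_isom. Qed.

End Isometries.

Definition reflective n (A : 'M[int]_n) (v : 'rV[int]_n) :=
  qform A v = 2 \/ qform A v = - 2.

(** Total in [v], so that it can be used before [v] is known to be reflective. *)
Definition refl n (A : 'M[int]_n) (v : 'rV[int]_n) : isom A :=
  if pselect (exists g : isom A, forall y, y *m isom_mx g = reflection A v y)
  is left e then projT1 (cid e) else 1%g.

Section Reflections.
Context (n : nat) (A : 'M[int]_n).
Hypothesis As : A^T = A.
Implicit Types (g h : isom A) (v x y : 'rV[int]_n).

Lemma reflE v y : reflective A v -> y *m isom_mx (refl A v) = reflection A v y.
Proof.
move=> rv; rewrite /refl; case: pselect => [e|[]]; first by case: cid.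
exact: reflection_isom.
Qed.

Lemma reflE2 v y : qform A v = 2 ->
  y *m isom_mx (refl A v) = y - form A v y *: v.
Proof.
move=> v2; rewrite reflE; last by left.
by rewrite /reflection v2 mulKz.
Qed.

Lemma reflEN2 v y : qform A v = - 2 ->
  y *m isom_mx (refl A v) = y + form A v y *: v.
Proof.
move=> v2; rewrite reflE; last by right.
by rewrite /reflection v2 divzN mulKz // scaleNr opprK.
Qed.

Lemma refl_invol v : reflective A v -> (refl A v * refl A v = 1)%g.
Proof.
move=> [v2|v2]; apply: isom_ext => y; rewrite mul_isomM mul_isom1.
  rewrite !reflE2 // formDr formNr formZr -/(qform A v) v2.
  have -> : form A v y - form A v y * 2 = - form A v y by ring.
  by rewrite scaleNr opprK subrK.
rewrite !reflEN2 // formDr formZr -/(qform A v) v2.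
have -> : form A v y + form A v y * - 2 = - form A v y by ring.
by rewrite scaleNr addrK.
Qed.

Lemma reflV v : reflective A v -> ((refl A v)^-1 = refl A v)%g.
Proof. by move=> rv; apply: mulg1_eq; exact: refl_invol. Qed.

Lemma refl_conj g v : reflective A v ->
  refl A (v *m isom_mx g) = (g^-1 * refl A v * g)%g.
Proof.
move=> rv; apply: isom_ext => y; rewrite !mul_isomM.
have E : form A (v *m isom_mx g) y = form A v (y *m isom_mx g^-1%g).
  by rewrite -[y in LHS](mul_isomVK g) form_isom.
case: (rv) => v2.
  by rewrite !reflE2 ?qform_isom // mulmxBl mul_isomVK -scalemxAl E.
by rewrite !reflEN2 ?qform_isom // mulmxDl mul_isomVK -scalemxAl E.
Qed.

Lemma reflN v : qform A v = 2 -> refl A (- v) = refl A v.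
Proof.
move=> v2; apply: isom_ext => y; rewrite !reflE2 //.
  by rewrite formNl scalerN scaleNr opprK.
by rewrite /qform formNl formNr opprK.
Qed.

(** The image of [w] under its own reflection is [- w], and under that of [v] it is
    [w] plus a multiple of [v]; the norms leave the factors 1 and -1 only. *)
Lemma refl_inj v w : qform A v = 2 -> qform A w = 2 -> refl A v = refl A w ->
  w = v \/ w = - v.
Proof.
move=> v2 w2 vw; have := reflE2 w v2; rewrite vw reflE2 //.
rewrite -/(qform A w) w2 => /addrI/oppr_inj E.
have : qform A (2 *: w) = qform A (form A v w *: v) by rewrite E.
rewrite !qformZ v2 w2; set k := form A v w in E * => kk.
have [k2|k2] : k = 2 \/ k = - 2 by nia.
  left; apply/eqP; rewrite -subr_eq0; have /eqP := E.
  by rewrite k2 -subr_eq0 -scalerBr scalemx_eq0.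
right; apply/eqP; rewrite -addr_eq0; have /eqP := E.
by rewrite k2 scaleNr -addr_eq0 -scalerDr scalemx_eq0.
Qed.

Lemma refl_groupE (V : set 'rV[int]_n) : (forall v, V v -> reflective A v) ->
  refl_group A V = generated (refl A @` V).
Proof.
move=> Vr; congr generated; apply/seteqP; split=> g [v Vv].
  move=> gE; exists v => //; apply: isom_ext => y.
  by rewrite gE reflE //; apply: Vr.
by move=> <-; exists v => // y; rewrite reflE //; apply: Vr.
Qed.

End Reflections.

Section Generated.
Context (G : groupType).
Implicit Types (S H : set G).

Lemma generated_subgroup S : is_subgroup (generated S).
Proof.
split.
- by move=> H [H1 _ _] _.
- move=> x y Sx Sy H HH SH; case: (HH) => _ HM _.
  by apply: HM; [exact: Sx | exact: Sy].
- by move=> x Sx H HH SH; case: (HH) => _ _ HV; apply: HV; exact: Sx.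
Qed.

Lemma sub_generated S : S `<=` generated S.
Proof. by move=> x Sx H _; apply. Qed.

End Generated.

(** A subgroup given as a subset, turned into a group in its own right: the
    universal property of a presentation is about groups, not subsets. *)
Section SubgroupType.
Context (G : groupType) (H : set G).

Definition subgroup_type (HH : is_subgroup H) := {x : G | `[< H x >]}.

Context (HH : is_subgroup H).

Lemma subgroup_closed : group_closed (fun x : G => `[< H x >]).
Proof.
case: HH => H1 HM HV; split; first exact/asboolP.
by move=> x y /asboolP Hx /asboolP Hy; apply/asboolP/HM => //; apply: HV.
Qed.

HB.instance Definition _ := Choice.on (subgroup_type HH).
HB.instance Definition _ := SubType.on (subgroup_type HH).
HB.instance Definition _ := SubChoice_isSubGroup.Build G
  (fun x : G => `[< H x >]) (subgroup_type HH) subgroup_closed.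

End SubgroupType.

(** * Reflection groups of Lorentzian lattices are Coxeter groups *)

Section ReflectionGroup.
Context (n : nat) (A : 'M[int]_n) (Phi : set 'rV[int]_n) (p : 'rV[int]_n).
Hypotheses (As : A^T = A) (Al : lorentzian A) (p0 : qform A p < 0).
Hypothesis p_gen : forall e, qform A e = 2 -> form A e p != 0.
Hypothesis Phi2 : forall e, Phi e -> qform A e = 2.
Hypothesis Phi_closed :
  forall e f, Phi e -> Phi f -> Phi (e *m isom_mx (refl A f)).
Implicit Types (e f : 'rV[int]_n) (g h : isom A).

Let H := refl_group A Phi.

Let Phi_reflective e : Phi e -> reflective A e.
Proof. by move=> /Phi2; left. Qed.

Lemma Phi_opp e : Phi e -> Phi (- e).
Proof.
move=> Pe; have := Phi_closed Pe Pe.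
rewrite reflE2 ?Phi2 // -/(qform A e) Phi2 // scaler_nat mulr2n opprD addrA.
by rewrite subrr add0r.
Qed.

Lemma Phi_isom e g : H g -> Phi e -> Phi (e *m isom_mx g).
Proof.
rewrite /H refl_groupE // => Hg; move: e.
have K : is_subgroup [set g : isom A | forall e, Phi e <-> Phi (e *m isom_mx g)].
  split=> [e|x y xP yP e|x xP e]; first by rewrite mul_isom1.
    by rewrite mul_isomM -yP -xP.
  by rewrite [X in _ <-> X]xP mul_isomVK.
move=> e; apply: (proj1 (Hg _ K _ e)) => _ [f Pf <-] {}e.
split=> [Pe|Pe]; first exact: Phi_closed.
rewrite -(mul_isomVK (refl A f) e) reflV //; first exact: Phi_closed.
exact: Phi_reflective.
Qed.

(** The base point [p] is integral, so heights are nonzero integers and can carry an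
    induction. *)
Definition height e := form A e p.

Definition separates e g := (0 < height e) (+) (0 < height (e *m isom_mx g)).

(** The mirror of a simple root is the only one that separates [p] from the
    reflection of [p]; the simple roots are the walls of the chamber of [p]. *)
Definition simple_root e := [/\ Phi e, 0 < height e &
  forall f, Phi f -> 0 < height f ->
    height f < height e * form A e f -> f = e].

(** The combination of [e] and [f] that is orthogonal to [p] has positive norm. *)
Lemma height_gram e f : Phi e -> Phi f -> 0 < height e -> 0 < height f ->
  f != e ->
  height e * height f * form A e f < height e ^+ 2 + height f ^+ 2.
Proof.
move=> Pe Pf ye xf nfe; pose v := height f *: e - height e *: f.
have vp : form A p v = 0.
  by rewrite formC // formDl formNl !formZl -/(height e) -/(height f); ring.
have v0 : v != 0.
  apply: contra_neq nfe => /eqP; rewrite subr_eq0 => /eqP E.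
  have : qform A (height f *: e) = qform A (height e *: f) by rewrite E.
  rewrite !qformZ !Phi2 // => /(mulIf _)-/(_ isT)/eqP.
  rewrite eqrXn2 ?ltW // => /eqP E'; apply/eqP; rewrite -subr_eq0.
  have /eqP := E; rewrite E' -subr_eq0 -scalerBr scalemx_eq0 gt_eqF //=.
  by rewrite -oppr_eq0 opprB.
have := Al p0 vp v0; rewrite /v qformD // -scaleNr !qformZ formZl formZr !Phi2 //.
set k := form A e f; set x := height f; set y := height e => ?; lia.
Qed.

(** If [e] is not simple, the mirror of some other positive [f] separates [p] from
    its image under the reflection in [e].  So does the mirror of [f' = k e - f],
    where [k = (e, f)], and the heights of [f] and [f'] add up to [k] times that of
    [e].  The lower of the two is at most half of that; [height_gram] improves this
    to the bounds that make the induction of [simple_gen_refl] work. *)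
Lemma descent e : Phi e -> 0 < height e -> ~ simple_root e ->
  exists f, [/\ Phi f, 0 < height f < height e &
    `|height (e *m isom_mx (refl A f))| < height e].
Proof.
move=> Pe ye ns.
have [f [Pf xf fe nfe]] : exists f, [/\ Phi f, 0 < height f,
    height f < height e * form A e f & f != e].
  apply: contrapT => Hn; apply: ns; split=> // f Pf xf fe.
  by apply: contrapT => /eqP nfe; apply: Hn; exists f.
have arith (x y k : int) : 0 < x -> 0 < y -> 0 < k -> 2 * x <= k * y ->
    y * x * k < y ^+ 2 + x ^+ 2 -> (x < y) && (`|y - k * x| < y).
  move=> x0 y0 k0 xk gram.
  have xy : x < y.
    rewrite ltNge; apply/negP => yx.
    have k2 : 2 <= k by nia.
    have h1 : (x - y) * (2 * x - k * y) <= 0.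
      by rewrite mulr_ge0_le0 ?subr_ge0 // subr_le0.
    have h2 : 0 <= (k - 2) * (x * y + y * y).
      by rewrite mulr_ge0 ?subr_ge0 // addr_ge0 // mulr_ge0 // ltW.
    have h3 : 2 * (x ^+ 2 + y ^+ 2 - y * x * k) =
        (x - y) * (2 * x - k * y) - (k - 2) * (x * y + y * y) by ring.
    lia.
  rewrite xy /=; have h1 : 0 < k * x by rewrite mulr_gt0.
  have h2 : x * x < y * y by rewrite ltr_pM // ltW.
  have : k * x < 2 * y.
    rewrite ltNge; apply/negP => yk.
    have : 2 * y * y <= k * x * y by rewrite ler_pM2r.
    have -> : k * x * y = y * x * k by ring.
    by rewrite -mulrA; move: gram; rewrite !expr2; lia.
  lia.
have hE f' : Phi f' -> height (e *m isom_mx (refl A f')) =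
    height e - form A e f' * height f'.
  move=> Pf'; rewrite reflE2 ?Phi2 // /height formDl formNl formZl.
  by rewrite (formC As f' e).
have k0 : 0 < form A e f by rewrite -(pmulr_rgt0 _ ye); apply: lt_trans xf fe.
have [low|high] := lerP (2 * height f) (form A e f * height e).
  have /andP[lt1 lt2] := arith _ _ _ xf ye k0 low (height_gram Pe Pf ye xf nfe).
  by exists f; split; rewrite ?xf ?lt1 // hE.
(* Otherwise take the opposite of the image of [f] under the reflection in [e]. *)
pose f' := - (f *m isom_mx (refl A e)).
have Pf' : Phi f' by apply/Phi_opp/Phi_closed.
have f'E : f' = form A e f *: e - f by rewrite /f' reflE2 ?Phi2 // opprB.
have hf' : height f' = form A e f * height e - height f.
  by rewrite f'E /height formDl formNl formZl.
have ef' : form A e f' = form A e f.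
  by rewrite f'E formDr formNr formZr -/(qform A e) Phi2 //; ring.
have xf' : 0 < height f' by rewrite hf' subr_gt0 mulrC.
have nf'e : f' != e.
  apply/eqP => f'e; have := hf'; rewrite f'e -ef' f'e -/(qform A e) Phi2 //.
  by move: high; rewrite -ef' f'e -/(qform A e) Phi2 //; lia.
have k0' : 0 < form A e f' by rewrite ef'.
have low : 2 * height f' <= form A e f' * height e by rewrite ef' hf'; lia.
have /andP[lt1 lt2] := arith _ _ _ xf' ye k0' low (height_gram Pe Pf' ye xf' nf'e).
by exists f'; split; rewrite ?xf' ?lt1 // hE.
Qed.

Let I := {e : 'rV[int]_n | `[< simple_root e >]}.
Let srefl (i : I) : isom A := refl A (val i).

Lemma height_neq0 e : Phi e -> height e != 0.
Proof. by move=> /Phi2; apply: p_gen. Qed.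

(** The reflection in [e] is conjugate, by the reflection in a lower root [f], to
    that in a root of smaller height. *)
Lemma simple_gen_refl e : Phi e -> exists a, word_val srefl a = refl A e.
Proof.
pose K g := exists a, word_val srefl a = g.
have KM g h : K g -> K h -> K (g * h)%g.
  by move=> [a <-] [b <-]; exists (a ++ b); rewrite word_val_cat.
suff pos m e' : Phi e' -> 0 < height e' -> height e' < m%:Z -> K (refl A e').
  move=> Pe; have := height_neq0 Pe; rewrite neq_lt => /orP[neg|ye].
    rewrite -(reflN As (Phi2 Pe)).
    have hN : height (- e) = - height e by exact: formNl.
    by apply: (pos (absz (height e)).+1); [exact: Phi_opp | rewrite hN; lia ..].
  by apply: (pos (absz (height e)).+1) => //; lia.
elim: m e' => [|m IH] e' Pe ye em; first by lia.
have [se|/descent[]// f [Pf /andP[xf fe] he]] := pselect (simple_root e').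
  have se' : `[< simple_root e' >] by apply/asboolP.
  by exists [:: exist _ e' se']; rewrite /= mulg1.
have Kf : K (refl A f) by apply: IH => //; lia.
pose e'' := e' *m isom_mx (refl A f).
have Pe'' : Phi e'' by exact: Phi_closed.
have Ke : K (refl A e'').
  have := height_neq0 Pe''; rewrite neq_lt => /orP[neg|ye''].
    rewrite -(reflN As (Phi2 Pe'')).
    have hN : height (- e'') = - height e'' by exact: formNl.
    by apply: IH; [exact: Phi_opp | rewrite hN; move: he; rewrite -/e''; lia ..].
  by apply: IH => //; move: he; rewrite -/e''; lia.
suff -> : refl A e' = (refl A f * refl A e'' * refl A f)%g.
  exact: KM _ _ (KM _ _ Kf Ke) Kf.
have rf := Phi_reflective Pf.
rewrite /e'' refl_conj //; last exact: Phi_reflective.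
rewrite reflV // !mulgA.
by rewrite refl_invol // mul1g -mulgA refl_invol // mulg1.
Qed.

Lemma simple_gen g : H g -> exists a, word_val srefl a = g.
Proof.
rewrite /H refl_groupE // => Hg.
apply: (Hg [set g | exists a, word_val srefl a = g]); last first.
  by move=> _ [e Pe <-]; exact: simple_gen_refl.
split=> [|_ _ [a <-] [b <-]|_ [a <-]]; first by exists [::].
  by exists (a ++ b); rewrite word_val_cat.
elim: a => [|i a [b bE]]; first by exists [::]; rewrite /= invg1.
exists (b ++ [:: i]); rewrite word_val_cat bE /= mulg1 invgM /srefl reflV //.
by apply: Phi_reflective; case: i => e /= /asboolP[].
Qed.

Lemma separatesN e g : Phi e -> separates (- e) g = separates e g.
Proof.
move=> Pe; have hN e' : height (- e') = - height e' by exact: formNl.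
have flip e' : height e' != 0 -> (0 < height (- e')) = ~~ (0 < height e').
  by rewrite hN; lia.
rewrite /separates mulNmx !flip; first by rewrite addbN addNb negbK.
  by apply: p_gen; rewrite qform_isom Phi2.
exact: height_neq0.
Qed.

(** The cocycle is expressed through roots: a reflection determines its root up to
    sign, and separation does not depend on that sign. *)
Lemma reflection_group_coxeter (HH : is_subgroup H) :
  coxeter_group (subgroup_type HH).
Proof.
have rH e : Phi e -> `[< H (refl A e) >].
  move=> Pe; apply/asboolP; rewrite /H refl_groupE //.
  by apply: sub_generated; exists e.
have valM (x y : subgroup_type HH) : val (x * y)%g = (val x * val y)%g by [].
have valV (x : subgroup_type HH) : val (x^-1)%g = ((val x)^-1)%g by [].
have val1 : val (1%g : subgroup_type HH) = 1%g by [].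
have IPhi (i : I) : Phi (val i) by case: i => e /= /asboolP[].
pose s (i : I) : subgroup_type HH := exist _ (refl A (val i)) (rH _ (IPhi i)).
have val_word a : val (word_val s a) = word_val srefl a.
  by elim: a => // i a IH; rewrite [LHS](valM (s i) (word_val s a)) IH.
pose N (w t : subgroup_type HH) :=
  `[< exists2 e, Phi e & val t = refl A e /\ separates e (val w) >].
have NE e w t : Phi e -> val t = refl A e -> N w t = separates e (val w).
  move=> Pe te; apply/asboolP/idP => [[f Pf [tf sf]]|sep]; last by exists e.
  case: (refl_inj As (Phi2 Pf) (Phi2 Pe) (etrans (esym tf) te)) => [->//|E].
  by rewrite E separatesN.
apply: (@cocycle_coxeter _ I s N) => [i j E|i|w|x y t|i t].
- apply: val_inj; have [_ yi _] : simple_root (val i) by case: (i) => e /= /asboolP.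
  have [_ yj _] : simple_root (val j) by case: (j) => e /= /asboolP.
  have /refl_inj[] // : refl A (val i) = refl A (val j) by exact: (congr1 val E).
  + exact: Phi2.
  + exact: Phi2.
  + move=> ji; move: yj; rewrite ji /height formNl oppr_gt0.
    by move=> /(lt_trans yi); rewrite ltxx.
- apply: val_inj; rewrite valM val1 /= refl_invol //.
  exact: Phi_reflective (IPhi i).
- have [|a aw] := @simple_gen (val w).
    by apply/asboolP; exact: valP w.
  by exists a; apply: val_inj; rewrite val_word.
- have [[e [Pe te]]|nt] := pselect (exists e, Phi e /\ val t = refl A e).
    have Hx : H (val x) by apply/asboolP; exact: valP x.
    rewrite (NE e _ t) // (NE e x t) // (NE (e *m isom_mx (val x))); first last.
    + by rewrite refl_conj //; [rewrite !valM valV te | exact: Phi_reflective].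
    + exact: Phi_isom.
    by rewrite /separates valM mul_isomM; do 3!case: (0 < _).
  have nN w : N w t = false.
    by apply/asboolP => -[e Pe [te _]]; apply: nt; exists e.
  rewrite !nN; apply/esym/asboolP => -[e Pe [te _]]; apply: nt.
  have Hx : H (val x)^-1%g by rewrite -valV; apply/asboolP; exact: (valP x^-1%g).
  exists (e *m isom_mx (val x)^-1%g); split; first exact: Phi_isom.
  rewrite refl_conj //; last exact: Phi_reflective.
  by rewrite -te !valM valV invgK !mulgA mulgV mul1g mulgK.
have [_ yi si] : simple_root (val i) by case: (i) => e /= /asboolP.
have hneg f : Phi f -> height (f *m isom_mx (refl A (val i))) =
    height f - height (val i) * form A (val i) f.
  by move=> Pf; rewrite reflE2 ?Phi2 // /height formDl formNl formZl mulrC.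
apply/asboolP/eqP => [[f Pf [tf]]|->]; last first.
  exists (val i); [exact: IPhi | split=> //].
  rewrite /separates (hneg _ (IPhi i)) yi /= -/(qform A (val i)).
  rewrite Phi2; last exact: IPhi.
  by rewrite -leNgt; move: yi => /=; move: (height (sval i)) => y; lia.
wlog xf : f Pf tf / 0 < height f => [wl|].
  have := height_neq0 Pf; rewrite neq_lt => /orP[neg|]; last exact: wl.
  rewrite -separatesN //; apply: wl; first exact: Phi_opp.
    by rewrite reflN // Phi2.
  by rewrite /height formNl oppr_gt0.
rewrite /separates xf /= hneg // -leNgt => le.
apply: val_inj; rewrite tf /=; congr (refl A _); apply: si => //.
rewrite lt_neqAle -subr_le0 le andbT -subr_eq0 -hneg //.
exact/height_neq0/Phi_closed.
Qed.

End ReflectionGroup.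

(** * Connectedness and automorphisms of graphs *)

Section Graphs.
Context (X : graph).
Implicit Types (x y : X) (S : set X) (h : X -> X).

Lemma connected_refl x : connected_to x x.
Proof. by exists [::]. Qed.

Lemma connected_trans x y z :
  connected_to x y -> connected_to y z -> connected_to x z.
Proof.
move=> [p xp <-] [q yq <-]; exists (p ++ q); last exact: last_cat.
by rewrite cat_path xp.
Qed.

Lemma connected_adj x y : adj x y -> connected_to x y.
Proof. by move=> xy; exists [:: y]; rewrite //= xy. Qed.

Lemma connected_ind x (P : X -> Prop) : P x ->
  (forall u w, connected_to x u -> P u -> adj u w -> P w) ->
  forall y, connected_to x y -> P y.
Proof.
move=> Px step y [p]; elim/last_ind: p y => [|p w IH] y; first by move=> _ <-.
rewrite rcons_path last_rcons => /andP[xp pw] <-.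
by apply: step pw; [exists p | exact: IH].
Qed.

Lemma connected_sym (adj_sym : forall x y, adj x y = adj y x) x y :
  connected_to x y -> connected_to y x.
Proof.
move: y; apply: connected_ind => [|u w _ ux uw]; first exact: connected_refl.
by apply: connected_trans ux; apply: connected_adj; rewrite adj_sym.
Qed.

Lemma connected_map h : (forall x y, adj (h x) (h y) = adj x y) ->
  forall x y, connected_to x y -> connected_to (h x) (h y).
Proof.
move=> hadj x; apply: connected_ind => [|u w _ hu uw]; first exact: connected_refl.
by apply: connected_trans hu _; apply: connected_adj; rewrite hadj.
Qed.

Definition restrict S S' h (hS : forall x, S x -> S' (h x)) :
    induced S -> induced S' :=
  fun v => SigSub (mem_set (hS (val v) (set_mem (valP v)))).

Lemma restrict_isomorphic S S' h h' :
    (forall x y, adj (h x) (h y) = adj x y) -> cancel h h' -> cancel h' h ->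
    (forall x, S x -> S' (h x)) -> (forall x, S' x -> S (h' x)) ->
  graph_isomorphic (induced S) (induced S').
Proof.
move=> hadj hK hK' hS hS'; exists (restrict hS); last by move=> x y; exact: hadj.
by exists (restrict hS') => x; apply: val_inj; rewrite /= ?hK ?hK'.
Qed.

Lemma automorphism_isometry h h' : cancel h h' -> cancel h' h ->
  (forall x y, adj (h x) (h y) = adj x y) -> graph_isometry h.
Proof.
move=> hK hK' hadj; split; first by exists h'.
have walk (f : X -> X) x y k : (forall x y, adj (f x) (f y) = adj x y) ->
    walk_length x y k -> walk_length (f x) (f y) k.
  move=> fadj [p [xp <- <-]]; exists (map f p).
  by rewrite path_map (eq_path (e' := @adj X)) // last_map size_map.
have h'adj x y : adj (h' x) (h' y) = adj x y by rewrite -hadj !hK'.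
have walkE x y k : walk_length (h x) (h y) k <-> walk_length x y k.
  by split=> [/(walk _ _ _ _ h'adj)|/(walk _ _ _ _ hadj)//]; rewrite !hK.
move=> x y k; rewrite /graph_dist walkE; split=> -[xy le]; split=> // l.
  by rewrite -walkE; apply: le.
by rewrite walkE; apply: le.
Qed.

End Graphs.

(** * The minimal distance graph *)

Section MinimalDistanceGraph.
Context (n : nat) (A : 'M[int]_n).
Hypothesis As : A^T = A.

Notation X := (min_dist_graph A).
Implicit Types (u w x y : X) (S : set X) (g h : isom A).

Lemma vertex_norm u : qform A (val u) = - 2.
Proof. exact/eqP/(valP u). Qed.

Lemma vertex_reflective u : reflective A (val u).
Proof. by right; exact: vertex_norm. Qed.

Lemma adjE u w : adj u w = (form A (val u) (val w) == - 3).
Proof. by []. Qed.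

Lemma adj_sym u w : adj u w = adj w u.
Proof. by rewrite !adjE formC. Qed.

Lemma act_proof g u : qform A (val u *m isom_mx g) == - 2.
Proof. by rewrite qform_isom vertex_norm. Qed.

Definition act g u : X := exist _ (val u *m isom_mx g) (act_proof g u).

Lemma val_act g u : val (act g u) = val u *m isom_mx g.
Proof. by []. Qed.

Lemma actM g h u : act (g * h)%g u = act h (act g u).
Proof. by apply: val_inj; rewrite /= mul_isomM. Qed.

Lemma act1 u : act 1%g u = u.
Proof. by apply: val_inj; rewrite /= mul_isom1. Qed.

Lemma actK g : cancel (act g) (act g^-1%g).
Proof. by move=> u; rewrite -actM mulgV act1. Qed.

Lemma actVK g : cancel (act g^-1%g) (act g).
Proof. by move=> u; rewrite -actM mulVg act1. Qed.

Lemma adj_act g u w : adj (act g u) (act g w) = adj u w.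
Proof. by rewrite !adjE !val_act form_isom. Qed.

Lemma edge_norm u w : adj u w -> qform A (val u - val w) = 2.
Proof.
rewrite adjE => /eqP uw; have -> : val u - val w = val u + -1 *: val w.
  by rewrite scaleN1r.
by rewrite qformD // qformZ !vertex_norm formZr uw.
Qed.

Lemma edge_refl u w : adj u w -> act (refl A (val u - val w)) u = w.
Proof.
move=> uw; apply: val_inj; rewrite val_act reflE2 ?edge_norm //.
move: uw; rewrite adjE => /eqP uw.
have -> : form A (val u - val w) (val u) = 1.
  by rewrite formDl formNl (formC As (val w)) uw -/(qform A (val u)) vertex_norm.
by rewrite scale1r opprB addrC subrK.
Qed.

Lemma component_eq S x : is_component S -> S x ->
  S = [set y | connected_to x y].
Proof.
move=> [z ->] /= zx; apply/seteqP; split=> y /= zy.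
  by apply: connected_trans zy; apply: connected_sym zx; exact: adj_sym.
exact: connected_trans zx zy.
Qed.

Lemma component_connected S x y : is_component S -> S x -> S y ->
  connected_to x y.
Proof. by move=> Sc Sx; rewrite (component_eq Sc Sx). Qed.

Lemma component_nonempty S : is_component S -> exists x, S x.
Proof. by move=> [x ->]; exists x; exact: connected_refl. Qed.

(** For an edge from [u] to [w] with difference [e], [r_w = r_e r_u r_e], so
    [r_u r_w] is the product of the reflections in [e r_u] and in [e].  Hence all
    reflections in vertices of [S] lie in one coset of the normal subgroup [R_2]. *)
Lemma component_refl_index S : is_component S ->
  let R_S := refl_group A [set val v | v in S] in
  let R_2 := refl_group A (vectors_of_norm A 2) in
  index_le R_S (R_S `&` R_2) 2.
Proof.
move=> Sc R_S R_2; have [x Sx] := component_nonempty Sc.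
have R2E : R_2 = generated (refl A @` vectors_of_norm A 2).
  by apply: refl_groupE => // v; left.
have RSE : R_S = generated (refl A @` [set val v | v in S]).
  by apply: refl_groupE => // _ [v _ <-]; exact: vertex_reflective.
have [R21 R2M R2V] : is_subgroup R_2 by rewrite R2E; exact: generated_subgroup.
have [RS1 RSM RSV] : is_subgroup R_S by rewrite RSE; exact: generated_subgroup.
have R2r e : qform A e = 2 -> R_2 (refl A e).
  by move=> e2; rewrite R2E; apply: sub_generated; exists e.
have R2J g k : R_2 k -> R_2 (g^-1 * k * g)%g.
  rewrite {1}R2E => Rk.
  apply: (Rk [set k | R_2 (g^-1 * k * g)%g]) => [|_ [e e2 <-] /=]; last first.
    by rewrite -refl_conj //; [apply: R2r; rewrite qform_isom | left].
  split=> [|a b aP bP|a aP] /=; first by rewrite mulg1 mulVg.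
    by have := R2M _ _ aP bP; rewrite !mulgA mulgK.
  by have := R2V _ aP; rewrite !invgM invgK mulgA.
pose r := refl A (val x).
have rr : (r * r = 1)%g by apply: refl_invol (vertex_reflective x).
have rV : (r^-1 = r)%g by apply: reflV (vertex_reflective x).
have RSr v : S v -> R_S (refl A (val v)).
  by move=> Sv; rewrite RSE; apply: sub_generated; exists (val v) => //; exists v.
have edge v : S v -> R_2 (r * refl A (val v))%g.
  rewrite (component_eq Sc Sx) /=; move: v.
  apply: connected_ind => [|u w _ Ru uw]; first by rewrite rr.
  have e2 := edge_norm uw; set e := val u - val w in e2.
  have -> : refl A (val w) = ((refl A e)^-1 * refl A (val u) * refl A e)%g.
    by rewrite -refl_conj // -?val_act ?edge_refl //; exact: vertex_reflective.
  have E : refl A (e *m isom_mx (refl A (val u))) =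
      (refl A (val u) * refl A e * refl A (val u))%g.
    by rewrite refl_conj // ?reflV //; [exact: vertex_reflective | left].
  have := R2M _ _ (R2M _ _ Ru (R2r (e *m isom_mx (refl A (val u))) _)) (R2r e e2).
  rewrite qform_isom E reflV //; last by left.
  move=> /(_ e2); congr (R_2 _).
  rewrite !mulgA -(mulgA r (refl A (val u))) refl_invol ?mulg1 //.
  exact: vertex_reflective.
have dich g : R_S g -> R_2 g \/ R_2 (r * g)%g.
  rewrite RSE => Rg; apply: (Rg [set g | R_2 g \/ R_2 (r * g)%g]); last first.
    by move=> _ [_ [v Sv <-] <-]; right; exact: edge.
  split=> [|a b aP bP|a [aP|aP]] /=; first by left.
  - case: aP bP => [aP|aP] [bP|bP].
    + by left; exact: R2M.
    + right; have := R2M _ _ (R2J r _ aP) bP.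
      by rewrite rV !mulgA -(mulgA _ r r) rr mulg1.
    + by right; rewrite mulgA; exact: R2M.
    + left; have := R2M _ _ (R2J r _ aP) bP.
      by rewrite rV !mulgA rr mul1g -(mulgA _ r r) rr mulg1.
  - by left; exact: R2V.
  - right; have := R2J r _ (R2V _ aP).
    by rewrite invgM !rV !mulgA -(mulgA _ r r) rr mulg1.
exists [:: 1%g; r]; split=> // [t|g Rg].
  by rewrite !inE => /orP[/eqP->|/eqP->] //; exact: RSr.
have [R2g|R2g] := dich g Rg.
  by exists 1%g; [rewrite inE eqxx | rewrite invg1 mul1g].
exists r; first by rewrite !inE eqxx orbT.
by rewrite rV; split=> //; apply: RSM => //; exact: RSr.
Qed.

Lemma act_isomorphic g u :
  graph_isomorphic (induced [set y : X | connected_to u y])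
                   (induced [set y : X | connected_to (act g u) y]).
Proof.
apply: (@restrict_isomorphic _ _ _ (act g) (act g^-1%g)).
- by move=> x y; exact: adj_act.
- exact: actK.
- exact: actVK.
- by move=> y; apply: connected_map; exact: adj_act.
move=> y /(connected_map (adj_act g^-1%g)) /=.
by rewrite actK.
Qed.

Section Lorentzian.
Hypotheses (Al : lorentzian A) (dA : \det A != 0).

(** In its majorant [u] has norm 2 and pairs with any [y] to [- (u, y)], so
    Cauchy's inequality bounds the pairings of [u] with a reduced basis. *)
Lemma bounded_marking : exists B : int, forall u, exists P : 'M[int]_n,
  [/\ P \in unitmx,
      forall i j, `|(P *m majorant A (val u) *m P^T) i j| <= B &
      forall i j, `|(P *m A *m (val u)^T) i j| <= B].
Proof.
have [B BP] := bounded_basis n `|\det A|; exists (2 * `|B|) => u.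
have u2 := vertex_norm u.
have Gs := majorant_sym (val u) As; have Gp := majorant_posdef As Al u2.
have [|P uP PB] := BP _ Gs Gp; first by rewrite norm_det_majorant.
exists P; split=> // i j.
  rewrite form_row; have := posdef_cauchy Gs Gp (row i P) (row j P).
  move: (PB i) (PB j) (posdef_ge0 Gp (row i P)) (posdef_ge0 Gp (row j P)).
  set a := qform _ (row i P); set b := qform _ (row j P); set c := form _ _ _.
  move=> aB bB a0 b0 cab; have : c ^+ 2 <= `|B| ^+ 2.
    by rewrite (le_trans cab) // expr2 ler_pM //; lia.
  move=> cB; have : `|c| <= `|B|; last by lia.
  by rewrite -(@ler_pXn2r _ 2) ?nnegrE // -normrX ger0_norm ?sqr_ge0.
have -> : (P *m A *m (val u)^T) i j = form A (row i P) (val u).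
  by rewrite ord1 /form -!row_mul [RHS]mxE.
have := posdef_cauchy Gs Gp (val u) (row i P).
rewrite qform_majorant // form_majorant // -/(qform A (val u)) u2.
rewrite (formC As _ (val u)).
move: (PB i) (posdef_ge0 Gp (row i P)).
set a := qform _ (row i P); set c := form _ _ _ => aB a0.
have -> : (c + - 2 * c) ^+ 2 = c ^+ 2 by ring.
by move=> ca; have : `|c| <= c ^+ 2; [nia | lia].
Qed.

(** The two data together give back the Gram matrix of the lattice in the basis [P],
    and the coordinates of [u] in this basis. *)
Lemma marking_orbit u w (P Q : 'M[int]_n) : P \in unitmx -> Q \in unitmx ->
    P *m majorant A (val u) *m P^T = Q *m majorant A (val w) *m Q^T ->
    P *m A *m (val u)^T = Q *m A *m (val w)^T ->
  exists g, act g u = w.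
Proof.
move=> uP uQ EG Eb.
have Ec : val u *m A *m P^T = val w *m A *m Q^T.
  by have := congr1 trmx Eb; rewrite !trmx_mul !trmxK As !mulmxA.
have EA : P *m A *m P^T = Q *m A *m Q^T.
  have split_majorant v (T : 'M[int]_n) : T *m majorant A v *m T^T =
      T *m A *m T^T + (T *m A *m v^T) *m (v *m A *m T^T).
    by rewrite /majorant mulmxDr mulmxDl !mulmxA.
  by move: EG; rewrite !split_majorant Eb Ec => /addIr.
have gP : is_isometry A (invmx P *m Q).
  rewrite /is_isometry unitmx_mul unitmx_inv uP uQ /=; apply/eqP.
  rewrite trmx_mul !mulmxA -(mulmxA _ Q A) -(mulmxA _ (Q *m A)) -EA.
  by rewrite !mulmxA mulVmx // mul1mx -mulmxA trmx_inv mulmxV ?unitmx_tr // mulmx1.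
exists (Isom gP); apply: val_inj; rewrite val_act /=.
pose v := val w *m invmx Q *m P.
have vE : v *m A = val u *m A.
  have : v *m A *m P^T = val u *m A *m P^T.
    rewrite Ec /v -!mulmxA (mulmxA P) EA -!mulmxA.
    by rewrite (mulmxA (invmx Q)) mulVmx // mul1mx.
  by move=> /(congr1 (mulmx^~ (invmx P^T))) /=; rewrite !mulmxK ?unitmx_tr.
have <- : v = val u.
  apply/eqP; rewrite -subr_eq0; have : (v - val u) *m A *m \adj A = 0.
    by rewrite mulmxBl vE subrr mul0mx.
  rewrite -mulmxA mul_mx_adj mul_mx_scalar => /eqP.
  by rewrite scalemx_eq0 (negbTE dA).
by rewrite /v -!mulmxA (mulmxA P) mulmxV // mul1mx mulmxA mulmxKV.
Qed.

Lemma finitely_many_types : exists F : set (set X),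
  [/\ finite_set F, F `<=` [set S | is_component S] &
    forall S : set X, is_component S ->
      exists2 S' : set X, F S' & graph_isomorphic (induced S) (induced S')].
Proof.
have [B BP] := bounded_marking.
pose K := [set M : 'M[int]_n | forall i j, `|M i j| <= B] `*`
          [set b : 'cV[int]_n | forall i j, `|b i j| <= B].
have finK : finite_set K by apply: finite_setX; apply: finite_bounded_mx.
pose marks u (d : 'M[int]_n * 'cV[int]_n) := exists2 P, P \in unitmx &
  d = (P *m majorant A (val u) *m P^T, P *m A *m (val u)^T).
have exD u : exists d, K d /\ marks u d.
  have [P [uP PG Pb]] := BP u.
  exists (P *m majorant A (val u) *m P^T, P *m A *m (val u)^T).
  by split; [split | exists P].
have [D DP] := choice exD.
(* One component for each value of the data; other values do not occur. *)
pose C d : set X := if pselect (exists u, D u = d) is left e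
  then [set y | connected_to (projT1 (cid e)) y] else set0.
exists (C @` range D); split.
- apply/finite_image/(sub_finite_set _ finK) => _ [u _ <-].
  by case: (DP u).
- move=> _ [_ [u _ <-] <-]; rewrite /C; case: pselect => [e|[]]; last by exists u.
  by exists (projT1 (cid e)).
move=> S [u ->]; exists (C (D u)); first by exists (D u) => //; exists u.
rewrite /C; case: pselect => [e|[]]; last by exists u.
case: cid => w /= Dw; have [_ [P uP PE]] := DP u; have [_ [Q uQ QE]] := DP w.
move: Dw; rewrite PE QE => -[EG Eb].
have [g <-] := marking_orbit uP uQ (esym EG) (esym Eb).
exact: act_isomorphic.
Qed.

(** The point reflections in the vertices of an edge generate a geodesic; here
    it is followed through the linear recursion [v_(k+2) = 3 v_(k+1) - v_k].
    The pairings with the first vertex strictly decrease, so no vertex repeats. *)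
Lemma edge_infinite S u w : is_component S -> S u -> adj u w -> infinite_set S.
Proof.
move=> Sc Su uw.
have step (x y : X) : adj x y -> exists z : X,
    adj y z /\ forall v,
      form A v (val z) = 3 * form A v (val y) - form A v (val x).
  rewrite adjE => /eqP xy; pose z := 3 *: val y - val x.
  have fz v : form A v z = 3 * form A v (val y) - form A v (val x).
    by rewrite formDr formNr formZr.
  have zN : qform A z == - 2.
    rewrite /qform fz !(formC As z) !fz -/(qform A (val y)) -/(qform A (val x)).
    by rewrite !vertex_norm xy (formC As (val y)) xy.
  exists (exist _ z zN); split=> //.
  by rewrite adjE /= fz -/(qform A (val y)) vertex_norm (formC As) xy.
have exn (xy : X * X) : exists yz : X * X, adj xy.1 xy.2 ->
    [/\ yz.1 = xy.2, adj yz.1 yz.2 & forall v,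
      form A v (val yz.2) = 3 * form A v (val xy.2) - form A v (val xy.1)].
  have [/step[z [yz zP]]|xy0] := boolP (adj xy.1 xy.2).
    by exists (xy.2, z).
  by exists xy => xy1; case/negP: xy0.
have [nxt nxtP] := choice exn.
pose c k := iter k nxt (u, w).
have cE k : c k.+1 = nxt (c k) by [].
have cadj k : adj (c k).1 (c k).2.
  by elim: k => // k IH; have [_ ? _] := nxtP _ IH.
have cS k : S (c k).1.
  elim: k => // k IH; have [-> _ _] := nxtP _ (cadj k).
  move: IH; rewrite (component_eq Sc Su) => /connected_trans; apply.
  exact/connected_adj/cadj.
pose d k := form A (val u) (val (c k).1).
have dS k : d k < 0 /\ form A (val u) (val (c k).2) < d k.
  elim: k => [|k [d0 dlt]].
    move: uw; rewrite adjE /d /= => /eqP->.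
    by rewrite -/(qform A (val u)) vertex_norm.
  have [E1 _ E2] := nxtP _ (cadj k).
  rewrite /d cE E1 E2; split; first exact: lt_trans dlt d0.
  by move: dlt d0; rewrite /d; lia.
have dlt k : d k.+1 < d k.
  by have [E1 _ _] := nxtP _ (cadj k); rewrite {1}/d cE E1; case: (dS k).
have dmono k l : (k < l)%N -> d l < d k.
  elim: l => // l IH; rewrite ltnS leq_eqVlt => /orP[/eqP->//|/IH].
  exact: lt_trans.
have c_inj : injective (fun k => (c k).1).
  move=> k l /= kl; have dkl : d k = d l by rewrite /d kl.
  by case: (ltngtP k l) => // /dmono; rewrite dkl ltxx.
move=> finS; apply: infinite_nat.
have -> : [set: nat] = (fun k => (c k).1) @^-1` S.
  by apply/seteqP; split=> k //= _; exact: cS.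
by apply: finite_preimage finS => k l _ _; exact: c_inj.
Qed.

(** An isometry that fixes [y] preserves its majorant, so it moves the standard
    basis inside a ball of that majorant. *)
Lemma vertex_stabilizer_finite y :
  finite_set [set M : 'M[int]_n |
    exists2 g : isom A, isom_mx g = M & act g y = y].
Proof.
pose G := majorant A (val y); pose e i : 'rV[int]_n := delta_mx 0 i.
have Gp := majorant_posdef As Al (vertex_norm y).
have [B BP] :=
  majorant_ball_bounded As Al (vertex_norm y) (\sum_i qform G (e i)) dA.
apply: sub_finite_set (finite_bounded_mx n n B) => _ [g <- gy] i j.
have := BP (row i (isom_mx g)) _ j; rewrite mxE; apply.
have yg : val y *m isom_mx g = val y by rewrite -val_act gy.
rewrite qform_majorant // rowE qform_isom -{1}yg form_isom -qform_majorant //.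
by rewrite (bigD1 i) //= lerDl sumr_ge0 // => k _; exact: posdef_ge0.
Qed.

(** The group acts on the left by inverses, since matrices act on row vectors on
    the right. *)
Lemma component_coxeter S u w : is_component S -> S u -> adj u w ->
  exists (W : groupType) (a : W -> induced S -> induced S),
    [/\ coxeter_group W, is_group_action a,
        forall g : W, graph_isometry (a g),
        forall x y : induced S, exists g : W, a g x = y &
        forall x : induced S, finite_set [set g : W | a g x = x]].
Proof.
move=> Sc Su uw.
pose Phi := [set e | qform A e = 2 /\ forall y, S y -> S (act (refl A e) y)].
have PhiE e : Phi e -> qform A e = 2 by case.
have Phir e : Phi e -> reflective A e by left; exact: PhiE.
have Phi_closed e f : Phi e -> Phi f -> Phi (e *m isom_mx (refl A f)).
  move=> [e2 eS] [f2 fS]; split=> [|y Sy]; first by rewrite qform_isom.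
  rewrite refl_conj //; last by left.
  by rewrite reflV //; [rewrite !actM; apply/fS/eS/fS | left].
have [p p0 pgen] := generic_point As Al dA (vertex_norm u).
pose H := refl_group A Phi.
have HE : H = generated (refl A @` Phi) by exact: refl_groupE.
have HH : is_subgroup H by rewrite HE; exact: generated_subgroup.
have [H1 HM HV] := HH.
have HS g : H g -> forall y, S y -> S (act g y).
  rewrite HE => Hg.
  suff : forall y, S y <-> S (act g y) by move=> E y /E.
  apply: (Hg [set g | forall y, S y <-> S (act g y)]) => [|_ [e Pe <-] y]; last first.
    split; first by case: Pe => _; apply.
    move=> /(proj2 Pe); rewrite -actM refl_invol ?act1 //; exact: Phir.
  split=> [y|a b aS bS y|a aS y]; first by rewrite act1.
    by rewrite actM -bS.
  by rewrite [X in _ <-> X]aS actVK.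
pose W := subgroup_type HH.
have Wg (g : W) : H (val g)^-1%g by apply: HV; apply/asboolP; exact: valP g.
pose a (g : W) := restrict (HS _ (Wg g)) : induced S -> induced S.
have val_a (g : W) (x : induced S) :
  val (a g x) = act (val g)^-1%g (val x) by [].
have edge_Phi x y : S x -> adj x y -> Phi (val x - val y).
  move=> Sx xy; split=> [|z]; first exact: edge_norm.
  rewrite (component_eq Sc Sx) /=.
  move=> /(connected_map (adj_act (refl A (val x - val y)))).
  by rewrite edge_refl //; apply: connected_trans; exact: connected_adj.
exists W, a; split.
- exact: reflection_group_coxeter As Al p0 pgen PhiE Phi_closed HH.
- split=> [x|g h x]; apply: val_inj; rewrite !val_a; first by rewrite /= invg1 act1.
  by rewrite -actM -invgM.
- move=> g; apply: (@automorphism_isometry _ _ (a g^-1%g)).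
  + by move=> x; apply: val_inj; rewrite !val_a /= invgK actVK.
  + by move=> x; apply: val_inj; rewrite !val_a /= invgK actK.
  + by move=> x y; exact: adj_act.
- move=> x y; have Sx : S (val x) := set_mem (valP x).
  have trans z : connected_to (val x) z -> exists2 g, H g & act g (val x) = z.
    move: z; apply: connected_ind => [|z t xz [g Hg <-] zt].
      by exists 1%g => //; exact: act1.
    exists (g * refl A (val (act g (val x)) - val t))%g; last first.
      by rewrite actM edge_refl.
    apply: HM => //; rewrite HE; apply: sub_generated.
    by eexists; first exact: (edge_Phi _ _ (HS _ Hg _ Sx) zt).
  have [g Hg gxy] := trans _ (component_connected Sc Sx (set_mem (valP y))).
  have Hg' : `[< H g^-1%g >] by apply/asboolP; exact: HV _ Hg.
  by exists (exist _ g^-1%g Hg'); apply: val_inj; rewrite val_a invgK.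
move=> x; pose f (g : W) := isom_mx (val g).
have f_inj : injective f by move=> g h gh; do 2!apply: val_inj.
apply: (sub_finite_set (B := f @^-1` [set M | exists2 g : isom A,
    isom_mx g = M & act g (val x) = val x])).
  move=> g /= gx; exists (val g) => //.
  have E := val_a g x; rewrite gx in E.
  by rewrite [in LHS]E actVK.
apply: finite_preimage (vertex_stabilizer_finite _) => g h _ _; exact: f_inj.
Qed.

Lemma component_dichotomy S : is_component S ->
  (exists x : X, S = [set x]) \/ (infinite_set S /\
   exists (W : groupType) (a : W -> induced S -> induced S),
     [/\ coxeter_group W, is_group_action a,
         forall g : W, graph_isometry (a g),
         forall x y : induced S, exists g : W, a g x = y &
         forall x : induced S, finite_set [set g : W | a g x = x]]).
Proof.
move=> Sc; have [x Sx] := component_nonempty Sc.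
have [[w xw]|iso] := pselect (exists w, adj x w).
  by right; split; [exact: edge_infinite Sx xw | exact: component_coxeter Sx xw].
left; exists x; rewrite (component_eq Sc Sx); apply/seteqP; split=> y /=; last first.
  by move=> ->; exact: connected_refl.
move: y; apply: connected_ind => // u w _ ux uw.
by case: iso; exists w; rewrite -ux.
Qed.

End Lorentzian.

End MinimalDistanceGraph.

Theorem proposition3 (R : realType) (n : nat) (A : 'M[int]_n)
  (hn : (3 <= n)%N) (A_sym : A^T = A) (A_nondeg : \det A != 0)
  (A_sig : has_signature (map_mx intr A : 'M[R]_n) n.-1 1)
  (A_iso : isotropic (map_mx intr A : 'M[rat]_n))
  (A_even : even_lattice A) :
  let X := min_dist_graph A in
  [/\ exists F : set (set X),
        [/\ finite_set F, F `<=` [set S | is_component S] &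
          forall S : set X, is_component S ->
            exists2 S' : set X, F S' & graph_isomorphic (induced S) (induced S')],
      forall S : set X, is_component S ->
        (exists x, S = [set x]) \/
        (infinite_set S /\
         exists (W : groupType) (a : W -> induced S -> induced S),
           [/\ coxeter_group W, is_group_action a,
               forall g, graph_isometry (a g),
               forall x y, exists g, a g x = y &
               forall x, finite_set [set g | a g x = x]]) &
      forall S : set X, is_component S ->
        let R_S := refl_group A [set val v | v in S] in
        let R_2 := refl_group A (vectors_of_norm A 2) in
        index_le R_S (R_S `&` R_2) 2].
Proof.
move=> X; have Al := signature_lorentzian A_sym A_sig; split.
- exact: finitely_many_types.
- exact: component_dichotomy.
- exact: component_refl_index.
Qed.
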